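(* Let $T$ be a finite tree, with either no half-edge or exactly one half-edge, and let $V_T$ be its number of vertices. If $T$ has no half-edge, then $S(T)\in\mathcal{A}$. If $T$ has exactly one half-edge, then $S(T)\in\mathcal{B}$. In both cases, $d_{S(T)}\le V_T$. As a consequence, $S(T)(\tfrac14)$ is a polynomial in $1/\pi$ with rational coefficients, of degree at most $\lfloor V_T/2\rfloor$.
   Context: Trees are finite, unrooted and unlabeled. A half-edge is an edge having only one extremity (a vertex of $T$); at most one half-edge is allowed. $V(T)$ is the vertex set and $E(T)$ the edge set, the latter including the half-edge if there is one. $\mathbb{Z}_+$ denotes the nonnegative integers and $\mathrm{Cat}_n=\frac1{n+1}\binom{2n}{n}$ is the $n$-th Catalan number. One defines the power series in $t$ $$S(T)=S(T)(t)=\sum_{(x_e)\in\mathbb{Z}_+^{E(T)}}\ \prod_{v\in V(T)}\mathrm{Cat}_{X_v}\,t^{X_v},\qquad X_v=\sum_{e\ni v}x_e,$$ where the last sum is over the edges $e$ (including the half-edge) incident to $v$. The series converges for $0<t\le 1/4$, and $S(T)(\frac14)$ is its value at $t=1/4$. For real $a,b,c$ with $c$ not a nonpositive integer, ${}_2F_1(a,b;c;z)=\sum_{n\ge0}\frac{(a)_n(b)_n}{(c)_n}\frac{z^n}{n!}$ with $(x)_n=x(x+1)\cdots(x+n-1)$. Set $$H_1(t)={}_2F_1(-\tfrac12,-\tfrac12;1;16t^2),\qquad H_2(t)={}_2F_1(-\tfrac12,\tfrac12;2;16t^2),$$ $$\mathcal{A}=\mathbb{Q}[t,t^{-1},H_1(t),H_2(t)],\qquad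 \mathcal{B}=\mathcal{A}[\sqrt{1-4t}],$$ viewed as algebras of Laurent series in $t$. The degree $d_b$ of $b\in\mathcal{B}$ is the minimal degree of a polynomial expression of $b$ in $H_1(t),H_2(t),\sqrt{1-4t}$ with coefficients in $\mathbb{Q}[t,t^{-1}]$, where $H_1(t)$ and $H_2(t)$ are given degree $2$, $\sqrt{1-4t}$ is given degree $1$, and Laurent polynomials in $t$ have degree $0$. *)

(* Defs.v *)
From HB Require Import structures.
From mathcomp Require Import all_boot all_order all_algebra.
From mathcomp Require Import fraction.
From mathcomp Require Import ring.
From mathcomp Require Import boolp classical_sets reals topology normedtype.
From mathcomp Require Import sequences exp trigo.
(* The notations of mpoly clash with those of the analysis library. *)
From mathcomp Require Import -(notations) mpoly.

Set Implicit Arguments.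
Unset Strict Implicit.
Unset Printing Implicit Defensive.

Import Order.TTheory GRing.Theory Num.Theory.
Import numFieldNormedType.Exports.

Local Open Scope ring_scope.

Record fps := FPS { fps_coef :> nat -> rat }.

HB.instance Definition _ := gen_eqMixin fps.
HB.instance Definition _ := gen_choiceMixin fps.

Lemma fpsP (f g : fps) : (forall n, f n = g n) <-> f = g.
Proof.
split=> [|-> //]; case: f g => [f] [g] /= fg; congr FPS; exact/funext.
Qed.

Definition fps_add (f g : fps) := FPS (fun n => f n + g n).
Definition fps_opp (f : fps) := FPS (fun n => - f n).
Definition fps_of_poly (p : {poly rat}) := FPS (fun n => p`_n).
Definition fps_mul (f g : fps) :=
  FPS (fun n => \sum_(i < n.+1) f i * g (n - i)%N).

Lemma fps_addA : associative fps_add.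
Proof. by move=> f g h; apply/fpsP => n /=; rewrite addrA. Qed.
Lemma fps_addC : commutative fps_add.
Proof. by move=> f g; apply/fpsP => n /=; rewrite addrC. Qed.
Lemma fps_add0 : left_id (fps_of_poly 0) fps_add.
Proof. by move=> f; apply/fpsP => n /=; rewrite coef0 add0r. Qed.
Lemma fps_addN : left_inverse (fps_of_poly 0) fps_opp fps_add.
Proof. by move=> f; apply/fpsP => n /=; rewrite coef0 addNr. Qed.

(* The ring axioms are transported from {poly rat}, one coefficient at a
   time. *)
Definition fps_agree n (f : fps) (p : {poly rat}) :=
  forall i, (i <= n)%N -> f i = p`_i.

Lemma fps_agree_trunc n (f : fps) : fps_agree n f (\poly_(i < n.+1) f i).
Proof. by move=> i ilen; rewrite coef_poly ltnS ilen. Qed.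

Lemma fps_agree_mul n (f g : fps) p q :
  fps_agree n f p -> fps_agree n g q -> fps_agree n (fps_mul f g) (p * q).
Proof.
move=> fp gq i ilen /=; rewrite coefM; apply: eq_bigr => j _.
have jlei : (j <= i)%N by rewrite -ltnS.
by rewrite fp ?gq ?(leq_trans _ ilen) ?leq_subr.
Qed.

Lemma fps_agree_add n (f g : fps) p q :
  fps_agree n f p -> fps_agree n g q -> fps_agree n (fps_add f g) (p + q).
Proof. by move=> fp gq i ilen /=; rewrite coefD fp ?gq. Qed.

Lemma fps_agree_eq (f g : fps) :
  (forall n, exists2 p, fps_agree n f p & fps_agree n g p) -> f = g.
Proof. by move=> fg; apply/fpsP => n; have [p -> // ->] := fg n. Qed.

Lemma fps_mulA : associative fps_mul.
Proof.
move=> f g h; apply: fps_agree_eq => n.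
have [F G H] := And3 (@fps_agree_trunc n f) (@fps_agree_trunc n g)
                     (@fps_agree_trunc n h).
eexists; first exact: (fps_agree_mul F (fps_agree_mul G H)).
by rewrite mulrA; apply: fps_agree_mul H; apply: fps_agree_mul.
Qed.

Lemma fps_mulC : commutative fps_mul.
Proof.
move=> f g; apply: fps_agree_eq => n.
have [F G] := conj (@fps_agree_trunc n f) (@fps_agree_trunc n g).
eexists; first exact: (fps_agree_mul F G).
by rewrite mulrC; apply: fps_agree_mul.
Qed.

Lemma fps_mul1 : left_id (fps_of_poly 1) fps_mul.
Proof.
move=> f; apply: fps_agree_eq => n; have F := @fps_agree_trunc n f.
exists (1 * \poly_(i < n.+1) f i); last by rewrite mul1r.
by apply: fps_agree_mul.
Qed.

Lemma fps_mulD : left_distributive fps_mul fps_add.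
Proof.
move=> f g h; apply: fps_agree_eq => n.
have [F G H] := And3 (@fps_agree_trunc n f) (@fps_agree_trunc n g)
                     (@fps_agree_trunc n h).
eexists; first exact: (fps_agree_mul (fps_agree_add F G) H).
by rewrite mulrDl; apply: fps_agree_add; apply: fps_agree_mul.
Qed.

Lemma fps_1neq0 : fps_of_poly 1 != fps_of_poly 0.
Proof. by apply/eqP => /fpsP /(_ 0%N) /=; rewrite coef1 coef0. Qed.

HB.instance Definition _ :=
  GRing.isZmodule.Build fps fps_addA fps_addC fps_add0 fps_addN.
HB.instance Definition _ :=
  GRing.Zmodule_isComNzRing.Build fps
    fps_mulA fps_mulC fps_mul1 fps_mulD fps_1neq0.

Lemma fps_coef0 n : (0 : fps) n = 0.
Proof. exact: coef0. Qed.
Lemma fps_coefM (f g : fps) n :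
  (f * g) n = \sum_(i < n.+1) f i * g (n - i)%N.
Proof. by []. Qed.

Definition fps_unit : {pred fps} := fun f => `[< exists g : fps, g * f = 1 >].
Definition fps_inv (f : fps) : fps :=
  if pselect (exists g : fps, g * f = 1) is left e then projT1 (cid e) else f.

Lemma fps_mulV : {in fps_unit, left_inverse 1 fps_inv *%R}.
Proof.
move=> f /asboolP uf; rewrite /fps_inv; case: pselect => // e.
by case: (cid e).
Qed.
Lemma fps_unitP (f g : fps) : g * f = 1 -> fps_unit f.
Proof. by move=> gf; apply/asboolP; exists g. Qed.
Lemma fps_inv_out : {in [predC fps_unit], fps_inv =1 id}.
Proof.
move=> f /= nuf; rewrite /fps_inv; case: pselect => // e.
by move: nuf; rewrite inE /= => /asboolP.
Qed.

HB.instance Definition _ :=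
  GRing.ComNzRing_hasMulInverse.Build fps fps_mulV fps_unitP fps_inv_out.

Lemma fps_low (f : fps) : f != 0 ->
  exists2 m, f m != 0 & forall i, (i < m)%N -> f i = 0.
Proof.
move=> f0; have ex : exists n, f n != 0.
  apply: contrapT => nex; case/eqP: f0; apply/fpsP => n.
  rewrite fps_coef0; apply/eqP; apply: contrapT => /negP fn.
  by apply: nex; exists n.
case: (ex_minnP ex) => m fm mmin; exists m => // i im.
by apply/eqP; apply: contraTT im => fi; rewrite -leqNgt mmin.
Qed.

Lemma fps_integral : GRing.integral_domain_axiom fps.
Proof.
move=> f g fg0; case: (eqVneq f 0) => //= /fps_low [a fa fmin].
case: (eqVneq g 0) => //= /fps_low [b gb gmin].
move/fpsP: fg0 => /(_ (a + b)%N); rewrite fps_coef0 fps_coefM.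
have alt : (a < (a + b).+1)%N by rewrite ltnS leq_addr.
rewrite (bigD1 (Ordinal alt)) //= addKn big1 ?addr0; last first.
  move=> i; rewrite -val_eqE /= => ia.
  case: (ltngtP i a) ia => // ia _; first by rewrite fmin ?mul0r.
  rewrite [X in _ * X]gmin ?mulr0 // ltn_subLR ?ltn_add2r //.
  by rewrite -ltnS.
by move/eqP; rewrite mulf_eq0 (negbTE fa) (negbTE gb).
Qed.

HB.instance Definition _ := GRing.ComUnitRing_isIntegral.Build fps fps_integral.

(* Q((t)) is the fraction field of Q[[t]]. *)
Notation laurent := {fraction fps}.
Notation laurent_of := (@FracField.tofrac fps).

Definition laurent_t : laurent := laurent_of (fps_of_poly 'X).

Definition laurent_polynomial (x : laurent) :=
  exists (p : {poly rat}) (n : nat), x = laurent_of (fps_of_poly p) / laurent_t ^+ n.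

Definition rising (x : rat) (n : nat) : rat := \prod_(i < n) (x + i%:R).

Definition hyp2F1_coef (a b c : rat) (n : nat) : rat :=
  rising a n * rising b n / rising c n / n`!%:R.

(* 2F1(a, b; c; 16 t^2) *)
Definition hyp2F1_16t2 (a b c : rat) : fps :=
  FPS (fun n => if odd n then 0 else hyp2F1_coef a b c n./2 * 16 ^+ n./2).

Definition H1 : laurent := laurent_of (hyp2F1_16t2 (- 2^-1) (- 2^-1) 1).
Definition H2 : laurent := laurent_of (hyp2F1_16t2 (- 2^-1) 2^-1 2).

(* The binomial series (1 - 4 t)^(1/2). *)
Definition fps_sqrt14t : fps := FPS (fun n => rising (- 2^-1) n / n`!%:R * 4 ^+ n).
Definition sqrt14t : laurent := laurent_of fps_sqrt14t.

Lemma fps_sqrt14t_rec n :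
  n.+1%:R * fps_sqrt14t n.+1 = (4 * n%:R - 2) * fps_sqrt14t n.
Proof.
rewrite /= /rising big_ord_recr /= factS natrM exprS.
have n0 : n`!%:R != 0 :> rat by rewrite pnatr_eq0 -lt0n fact_gt0.
have n1 : n.+1%:R != 0 :> rat by rewrite pnatr_eq0.
by field; rewrite n0 addrC natr1.
Qed.

Lemma fps_sqrt14t_sqr : fps_sqrt14t ^+ 2 = fps_of_poly (1 - 4 *: 'X).
Proof.
have s0 : fps_sqrt14t 0%N = 1.
  by rewrite /= /rising big_ord0 fact0 expr0 divr1.
move: (fps_sqrt14t) s0 fps_sqrt14t_rec => s s0 srec; pose w := s ^+ 2.
have w0 : w 0%N = 1.
  by rewrite /w expr2 fps_coefM big_ord1 s0.
have wS n : n.+1%:R * w n.+1 = (4 * n%:R - 4) * w n.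
  have sym m (F : nat -> nat -> rat) :
      \sum_(i < m.+1) F i (m - i)%N = \sum_(i < m.+1) F (m - i)%N i.
    rewrite (reindex_inj rev_ord_inj) /=; apply: eq_bigr => i _.
    by rewrite subSS subKn // -ltnS.
  have dbl m : m%:R * w m = 2 * \sum_(i < m.+1) i%:R * s i * s (m - i)%N.
    rewrite [RHS]mulr_natl mulr2n [X in _ + X](sym m (fun i j => i%:R * s i * s j)).
    rewrite -big_split /w expr2 fps_coefM mulr_sumr; apply: eq_bigr => i _ /=.
    by rewrite natrB -1?ltnS //; ring.
  rewrite dbl big_ord_recl /= !mul0r add0r.
  have -> : (4 * n%:R - 4) * w n = 4 * (n%:R * w n) - 4 * w n by ring.
  rewrite dbl /w expr2 fps_coefM !mulr_sumr -sumrB; apply: eq_bigr => i _ /=.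
  rewrite /bump /= add1n subSS.
  by rewrite (srec i); ring.
have wSS n : w n.+2 = 0.
  have n0 m : m.+1%:R != 0 :> rat by rewrite pnatr_eq0.
  elim: n => [|n IHn].
    by apply: (mulfI (n0 1%N)); rewrite wS mulr0 mulr1 subrr mul0r.
  by apply: (mulfI (n0 n.+2)); rewrite wS IHn !mulr0.
apply/fpsP => k; rewrite -[LHS]/(w k) [RHS]/= coefB coef1 coefZ coefX.
case: k => [|[|n]].
- by rewrite w0 mulr0 subr0.
- by have := wS 0%N; rewrite w0 mul1r mulr0 !sub0r !mulr1 => ->.
- by rewrite wSS mulr0 subr0.
Qed.

Definition polynomial_expression n (g : n.-tuple laurent)
    (P : mpoly n laurent) (b : laurent) :=
  (forall m, laurent_polynomial (mcoeff m P)) /\ meval (tnth g) P = b.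

Definition gensA : 2.-tuple laurent := [tuple H1; H2].
Definition gensB : 3.-tuple laurent := [tuple H1; H2; sqrt14t].

Definition algA : set laurent :=
  [set b | exists P, polynomial_expression gensA P b]%classic.
Definition algB : set laurent :=
  [set b | exists P, polynomial_expression gensB P b]%classic.

Definition weightsB : 3.-tuple nat := [tuple 2; 2; 1]%N.

Definition weighted_degree (P : mpoly 3 laurent) : nat :=
  (\max_(m <- msupp P) \sum_(i < 3) tnth weightsB i * m i)%N.

Definition expression_degree (b : laurent) : pred nat := fun d =>
  `[< exists2 P, polynomial_expression gensB P b & weighted_degree P = d >].

(* Only meaningful on algB: the value elsewhere is a dummy 0. *)
Definition degB (b : laurent) : nat :=
  if pselect (exists d, expression_degree b d) is left e then ex_minn e else 0.

(* The edges of a graph on V are encoded by their sets of extremities: an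
   ordinary edge is a pair of vertices, a half-edge is a singleton. *)
Section Tree.
Variables (V : finType) (E : {set {set V}}).

Definition half_edges : {set {set V}} := [set e in E | #|e| == 1%N].

Definition graph_adj : rel V := fun u v => (u != v) && ([set u; v] \in E).

Definition connected_graph := forall u v, connect graph_adj u v.

(* A cycle of length 2 goes back and forth along an edge. *)
Definition acyclic_graph := forall p, ucycle graph_adj p -> (size p <= 2)%N.

Definition is_tree :=
  [/\ (0 < #|V|)%N,
      forall e, e \in E -> (#|e| == 1%N) || (#|e| == 2%N),
      (#|half_edges| <= 1)%N,
      connected_graph & acyclic_graph].

Definition edge := {e : {set V} | e \in E}.

Definition vertex_sum (x : edge -> nat) (v : V) : nat :=
  (\sum_(e : edge | v \in val e) x e)%N.

Definition total_sum (x : edge -> nat) : nat := (\sum_v vertex_sum x v)%N.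

Definition Cat (n : nat) : rat := 'C(n.*2, n)%:R / n.+1%:R.

(* The coefficient of t^n collects the families x with total_sum x = n; by
   label_le_total_sum below these take values at most n. *)
Definition treeS : fps :=
  FPS (fun n => \sum_(x : {ffun edge -> 'I_n.+1} | total_sum (val \o x) == n)
                  \prod_v Cat (vertex_sum (val \o x) v)).

Lemma label_le_total_sum (x : edge -> nat) (e : edge) :
  is_tree -> (x e <= total_sum x)%N.
Proof.
case=> _ cardE _ _ _; have /card_gt0P [v ve] : (0 < #|val e|)%N.
  by case/orP: (cardE _ (valP e)) => /eqP ->.
rewrite /total_sum (bigD1 v) //= /vertex_sum (bigD1 e) //=.
by rewrite -addnA leq_addr.
Qed.

End Tree.

(* Main.v *)
(** Expand in powers of t, with Laurent polynomials in y as coefficients, and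
    attach to every vertex v a series G_v such that an edge sum X at v is
    weighted by the coefficient of y^(-X) in G_v; initially G_v = Cat (t / y).
    Summing over the label of the edge joining a leaf l to v removes l and
    multiplies G_v by the image, under y -> 1/y, of the part of G_l of
    nonpositive y-degree.  What remains at the root is the coefficient of y^0
    or, if there is a half-edge, the nonpositive part at y = 1.

    Let s1 = sqrt (1 - 4 t / y), s2 = sqrt (1 - 4 t y) and let w-, w+ be the
    parts of w = s1 s2 of negative and positive y-degree.  The constant term
    of w is H1, and all its coefficients are combinations of H1 and H2 over
    Q[t, 1/t], because w^2 is a Laurent polynomial.  The relations
    (w- + H1 + w+)^2 = w^2, s1 w = (1 - 4 t / y) s2 and s2 w = (1 - 4 t y) s1
    rewrite every polynomial in s1, s2, w-, w+ as a combination of the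
    one-sided products s1^e w-^k and s2^e w+^k with e <= 1.  These span an
    algebra that is therefore also closed under taking the part of nonpositive
    y-degree; it contains t^2 Cat (t / y), and its filtration by e + 2k gives
    the bound on the degree of S(T).

    At t = 1/4 the partial sums of H1, H2 and sqrt (1 - 4 t) are elementary
    in C(2n, n) / 4^n, so their values follow from Wallis's product. *)

Require Import Defs.
From HB Require Import structures.
From mathcomp Require Import all_boot all_order all_algebra.
From mathcomp Require Import fraction.
From mathcomp Require Import boolp classical_sets reals topology normedtype.
From mathcomp Require Import sequences exp trigo.
From mathcomp Require Import functions derive.
From mathcomp Require Import -(notations) mpoly.
From mathcomp Require Import ring lra zify.

Import Order.TTheory GRing.Theory Num.Theory.
Import numFieldNormedType.Exports.

Local Open Scope ring_scope.

Set Implicit Arguments.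
Unset Strict Implicit.
Unset Printing Implicit Defensive.

(** * Power series over a commutative ring *)

Section PowerSeries.
Variable K : comNzRingType.

Record pser := PSer { pcoef :> nat -> K }.

HB.instance Definition _ := gen_eqMixin pser.
HB.instance Definition _ := gen_choiceMixin pser.

Lemma pserP (f g : pser) : (forall n, f n = g n) <-> f = g.
Proof.
split=> [|-> //]; case: f g => [f] [g] /= fg; congr PSer; exact/funext.
Qed.

Definition pser_poly (p : {poly K}) := PSer (fun n => p`_n).
Definition pser_add (f g : pser) := PSer (fun n => f n + g n).
Definition pser_opp (f : pser) := PSer (fun n => - f n).
Definition pser_mul (f g : pser) :=
  PSer (fun n => \sum_(i < n.+1) f i * g (n - i)%N).

(** The ring axioms come from [{poly K}]: the coefficients of index at most n of a product depend
    only on the truncations of its factors at n. *)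
Let trunc n (f : pser) := \poly_(i < n.+1) f i.

Let truncE n f i : (i <= n)%N -> (trunc n f)`_i = f i.
Proof. by move=> ilen; rewrite coef_poly ltnS ilen. Qed.

Let truncM n f g i : (i <= n)%N ->
  (trunc n (pser_mul f g))`_i = (trunc n f * trunc n g)`_i.
Proof.
move=> ilen; rewrite truncE // coefM; apply: eq_bigr => j _.
by rewrite !truncE // ?(leq_trans _ ilen) ?leq_subr // -ltnS.
Qed.

Let truncMl n (p q r : {poly K}) i : (forall j, (j <= n)%N -> p`_j = q`_j) ->
  (i <= n)%N -> (p * r)`_i = (q * r)`_i.
Proof.
move=> pq ilen; rewrite !coefM; apply: eq_bigr => j _; rewrite pq //.
by rewrite (leq_trans _ ilen) // -ltnS.
Qed.

Lemma pser_addA : associative pser_add.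
Proof. by move=> f g h; apply/pserP => n /=; rewrite addrA. Qed.
Lemma pser_addC : commutative pser_add.
Proof. by move=> f g; apply/pserP => n /=; rewrite addrC. Qed.
Lemma pser_add0 : left_id (pser_poly 0) pser_add.
Proof. by move=> f; apply/pserP => n /=; rewrite coef0 add0r. Qed.
Lemma pser_addN : left_inverse (pser_poly 0) pser_opp pser_add.
Proof. by move=> f; apply/pserP => n /=; rewrite coef0 addNr. Qed.

Lemma pser_mulC : commutative pser_mul.
Proof.
move=> f g; apply/pserP => n.
by rewrite -!(@truncE n _ n) // !truncM // mulrC.
Qed.

Lemma pser_mulA : associative pser_mul.
Proof.
move=> f g h; apply/pserP => n; rewrite -!(@truncE n _ n) // !truncM // mulrC.
have tM a b i : (i <= n)%N ->
  (trunc n (pser_mul a b))`_i = (trunc n a * trunc n b)`_i by exact: truncM.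
by rewrite (truncMl _ (tM g h)) // (truncMl _ (tM f g)) // mulrC mulrA.
Qed.

Lemma pser_mul1 : left_id (pser_poly 1) pser_mul.
Proof.
move=> f; apply/pserP => n /=; rewrite big_ord_recl /= coef1 mul1r subn0.
by rewrite big1 ?addr0 // => i _; rewrite coef1 mul0r.
Qed.

Lemma pser_mulD : left_distributive pser_mul pser_add.
Proof.
move=> f g h; apply/pserP => n /=; rewrite -big_split.
by apply: eq_bigr => i _; rewrite /= mulrDl.
Qed.

Lemma pser_1neq0 : pser_poly 1 != pser_poly 0.
Proof.
by apply/eqP => /pserP /(_ 0%N) /= /eqP; rewrite coef1 coef0 oner_eq0.
Qed.

HB.instance Definition _ :=
  GRing.isZmodule.Build pser pser_addA pser_addC pser_add0 pser_addN.
HB.instance Definition _ :=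
  GRing.Zmodule_isComNzRing.Build pser
    pser_mulA pser_mulC pser_mul1 pser_mulD pser_1neq0.

Lemma pser_coef0 n : (0 : pser) n = 0.
Proof. exact: coef0. Qed.
Lemma pser_coef1 n : (1 : pser) n = (n == 0%N)%:R.
Proof. exact: coef1. Qed.
Lemma pser_coefD (f g : pser) n : (f + g) n = f n + g n.
Proof. by []. Qed.
Lemma pser_coefN (f : pser) n : (- f) n = - f n.
Proof. by []. Qed.
Lemma pser_coefM (f g : pser) n :
  (f * g) n = \sum_(i < n.+1) f i * g (n - i)%N.
Proof. by []. Qed.

End PowerSeries.

Lemma fps_coefD (f g : fps) n : (f + g) n = f n + g n.
Proof. by []. Qed.
Lemma fps_coefN (f : fps) n : (- f) n = - f n.
Proof. by []. Qed.
Lemma fps_coef1 n : (1 : fps) n = (n == 0%N)%:R.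
Proof. exact: coef1. Qed.
Lemma fps_coef_sum (I : finType) (Q : pred I) (F : I -> fps) n :
  (\sum_(i | Q i) F i) n = \sum_(i | Q i) F i n.
Proof.
by apply: (big_morph (fun f : fps => f n)) => //; rewrite fps_coef0.
Qed.

Definition fps_t : fps := fps_of_poly 'X.

Lemma fps_coef_tM (f : fps) n : (fps_t * f) n = if n is m.+1 then f m else 0.
Proof.
case: n => [|n]; rewrite fps_coefM big_ord_recl /= coefX mul0r add0r.
  by rewrite big_ord0.
rewrite big_ord_recl /= coefX mul1r subn1 big1 ?addr0 // => i _.
by rewrite coefX mul0r.
Qed.

(** * Laurent polynomials in y with coefficients graded by powers of t *)

(* The element [q^m y^k] stands for [t^m y^(k - m)]; thus [t = q y], and
   [p = t y = q y^2] is the mirror image of [q = t / y].  The series in t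
   [cf G d] is the coefficient of [y^d] in G. *)
Notation lser := (pser {poly rat}).

(** Integer indices, with value 0 at the negative ones, allow shifts of the y-degree without side
    conditions. *)
Definition icoef (h : {poly rat}) (k : int) : rat :=
  if k is Posz i then h`_i else 0.

Definition cf (G : lser) (d : int) : fps :=
  FPS (fun m => icoef (G m) (m%:Z + d)).

Definition pser_lin (c : {poly rat}) : lser :=
  PSer (fun m => if m == 1%N then c else 0).
Definition lq : lser := pser_lin 1.
Definition lp : lser := pser_lin 'X^2.

(** Since t = q y, the monomial t^m is q^m y^m: series in t are embedded as the elements of y-degree
    0. *)
Definition liota (a : fps) : lser := PSer (fun m => a m *: 'X^m).

(** The y-degree of q^m y^k is k - m, so the terms of nonpositive degree are those with k <= m. *)
Definition npart (G : lser) : lser := PSer (fun m => take_poly m.+1 (G m)).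

(** The mirror image of [npart G]: t^m y^(i - m) becomes t^m y^(m - i), which has index 2 m - i in
    row m. *)
Definition fpart (G : lser) : lser :=
  PSer (fun m => \sum_(i < m.+1) (G m)`_i *: 'X^(m + m - i)).

(** The substitution y -> 1/y is a relation because it is only partial on [lser]: row m has a mirror
    image only if its degree is at most 2 m. *)
Definition flip (G G' : lser) := forall d, cf G' d = cf G (- d).

Lemma icoefD h g k : icoef (h + g) k = icoef h k + icoef g k.
Proof. by case: k => i /=; rewrite ?coefD ?addr0. Qed.
Lemma icoefN h k : icoef (- h) k = - icoef h k.
Proof. by case: k => i /=; rewrite ?coefN ?oppr0. Qed.
Lemma icoef0 k : icoef 0 k = 0.
Proof. by case: k => i //=; rewrite coef0. Qed.
Lemma icoefZ a h k : icoef (a *: h) k = a * icoef h k.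
Proof. by case: k => i /=; rewrite ?coefZ ?mulr0. Qed.
Lemma icoef_sum (I : finType) (Q : pred I) (F : I -> {poly rat}) k :
  icoef (\sum_(i | Q i) F i) k = \sum_(i | Q i) icoef (F i) k.
Proof.
by apply: (big_morph (fun h => icoef h k)); [move=> *; apply: icoefD|apply: icoef0].
Qed.
Lemma icoefXn n k : icoef 'X^n k = (k == n%:Z)%:R.
Proof. by case: k => i /=; rewrite ?coefXn. Qed.
Lemma icoefXnM n h k : icoef ('X^n * h) k = icoef h (k - n%:Z).
Proof.
case: k => i; last first.
  by rewrite /=; case E: (_ - _) => [j|j] //; lia.
rewrite /= coefXnM; case: ltnP => ni.
  by case E: (_ - _) => [j|j] //; lia.
by rewrite subzn.
Qed.

Lemma cfE G d m : cf G d m = icoef (G m) (m%:Z + d).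
Proof. by []. Qed.
Lemma cfD F G d : cf (F + G) d = cf F d + cf G d.
Proof. by apply/fpsP => m; rewrite cfE icoefD. Qed.
Lemma cfN F d : cf (- F) d = - cf F d.
Proof. by apply/fpsP => m; rewrite /= icoefN. Qed.
Lemma cfB F G d : cf (F - G) d = cf F d - cf G d.
Proof. by rewrite cfD cfN. Qed.

Lemma cfP F G : (forall d, cf F d = cf G d) -> F = G.
Proof.
move=> FG; apply/pserP => m; apply/polyP => i.
have /fpsP /(_ m) /= := FG (i%:Z - m%:Z).
by rewrite addrC subrK.
Qed.

Lemma cf_liota a d : cf (liota a) d = if d == 0 then a else 0.
Proof.
apply/fpsP => m /=; rewrite icoefZ icoefXn.
have -> : (m%:Z + d == m%:Z) = (d == 0) by lia.
by case: eqP; rewrite ?mulr1 ?mulr0 ?fps_coef0.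
Qed.

Fact liota_is_zmod_morphism : zmod_morphism liota.
Proof.
by move=> a b; apply/pserP => m; apply: scalerBl.
Qed.
HB.instance Definition _ :=
  GRing.isZmodMorphism.Build fps lser liota liota_is_zmod_morphism.

Fact liota_is_monoid_morphism : monoid_morphism liota.
Proof.
split=> [|a b]; apply/pserP => m.
  by rewrite pser_coef1 /= coef1; case: m => [|m]; rewrite ?scale1r ?scale0r.
rewrite pser_coefM /= scaler_suml; apply: eq_bigr => i _.
by rewrite -scalerAl -scalerAr scalerA -exprD subnKC // -ltnS.
Qed.
HB.instance Definition _ :=
  GRing.isMonoidMorphism.Build fps lser liota liota_is_monoid_morphism.

Lemma pser_linM c (G : lser) m :
  (pser_lin c * G) m = if m is n.+1 then c * G n else 0.
Proof.
case: m => [|n]; rewrite pser_coefM big_ord_recl /= mul0r add0r.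
  by rewrite big_ord0.
by rewrite big_ord_recl /= subn1 big1 ?addr0 // => i _; rewrite mul0r.
Qed.

Lemma cf_lpM G d : cf (lp * G) d = fps_t * cf G (d - 1).
Proof.
apply/fpsP => m; rewrite fps_coef_tM cfE pser_linM.
case: m => [|m]; first exact: icoef0.
by rewrite icoefXnM /=; congr icoef; lia.
Qed.

Lemma cf_lqM G d : cf (lq * G) d = fps_t * cf G (d + 1).
Proof.
apply/fpsP => m; rewrite fps_coef_tM cfE pser_linM.
case: m => [|m]; first exact: icoef0.
by rewrite mul1r /=; congr icoef; lia.
Qed.

Lemma cf_liotaM a G d : cf (liota a * G) d = a * cf G d.
Proof.
apply/fpsP => m; rewrite fps_coefM cfE pser_coefM icoef_sum; apply: eq_bigr => i _.
rewrite /= -scalerAl icoefZ icoefXnM; congr (_ * icoef _ _).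
by case: i => /= i; lia.
Qed.

Lemma lpq : lp * lq = liota (fps_t ^+ 2).
Proof.
apply: cfP => d; rewrite cf_lpM -[lq]mulr1 cf_lqM -(rmorph1 liota) !cf_liota.
by rewrite subrK; case: eqP => _; rewrite ?mulr1 ?mulr0.
Qed.

Lemma npartD F G : npart (F + G) = npart F + npart G.
Proof. by apply/pserP => m; rewrite /= take_polyD. Qed.

Lemma cf_npart G d : cf (npart G) d = if d <= 0 then cf G d else 0.
Proof.
apply/fpsP => m; case: ifP => dle; rewrite ?fps_coef0 /=.
  case E: (_ + _) => [i|] //=; rewrite coef_take_poly ifT //; lia.
case E: (_ + _) => [i|] //=; rewrite coef_take_poly ifF //; lia.
Qed.

Lemma cf_fpart G d : cf (fpart G) d = if 0 <= d then cf G (- d) else 0.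
Proof.
apply/fpsP => m; rewrite /= icoef_sum.
under eq_bigr => i _ do rewrite icoefZ icoefXn.
case: ifP => dge; rewrite ?fps_coef0 /=; last first.
  rewrite big1 // => i _; have il := ltn_ord i.
  by rewrite (_ : (_ == _) = false) ?mulr0 //; lia.
case E: (m%:Z - d) => [j|j] /=; last first.
  rewrite big1 // => i _; have il := ltn_ord i.
  by rewrite (_ : (_ == _) = false) ?mulr0 //; lia.
have jm : (j < m.+1)%N by lia.
rewrite (bigD1 (Ordinal jm)) //= big1 ?addr0 => [|i].
  by rewrite (_ : (_ == _) = true) ?mulr1 //; lia.
rewrite -val_eqE /= => ij; have il := ltn_ord i.
by rewrite (_ : (_ == _) = false) ?mulr0 //; lia.
Qed.

Lemma flip_fpart G : flip (npart G) (fpart G).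
Proof.
by move=> d; rewrite cf_fpart cf_npart oppr_le0.
Qed.

Lemma flip_sym F G : flip F G -> flip G F.
Proof. by move=> FG d; rewrite FG opprK. Qed.

Lemma flip_uniq F G G' : flip F G -> flip F G' -> G = G'.
Proof. by move=> FG FG'; apply: cfP => d; rewrite FG FG'. Qed.

Lemma flipD F F' G G' : flip F F' -> flip G G' -> flip (F + G) (F' + G').
Proof. by move=> f g d; rewrite !cfD f g. Qed.

Lemma flip_liotaM a G G' : flip G G' -> flip (liota a * G) (liota a * G').
Proof. by move=> g d; rewrite !cf_liotaM g. Qed.

Lemma flip_lpM G G' : flip G G' -> flip (lp * G) (lq * G').
Proof. by move=> g d; rewrite cf_lpM cf_lqM g; congr (_ * cf _ _); lia. Qed.

Lemma flip_lqM G G' : flip G G' -> flip (lq * G) (lp * G').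
Proof. by move=> g d; rewrite cf_lpM cf_lqM g; congr (_ * cf _ _); lia. Qed.

(** On row m, y -> 1/y exchanges the indices k and 2 m - k; such reversals are multiplicative,
    whence [flipM]. *)
Definition revp (N : nat) (h h' : {poly rat}) :=
  forall k, icoef h' k = icoef h (N%:Z - k).

Lemma revpP N h h' :
  revp N h h' ->
  h = \sum_(i < N.+1) h`_i *: 'X^i /\ h' = \sum_(i < N.+1) h`_i *: 'X^(N - i).
Proof.
move=> hh'; split; apply/polyP => j.
  rewrite -poly_def coef_poly; case: ltnP => // jN.
  have := hh' (N%:Z - j%:Z); rewrite subKr /=.
  by case E: (_ - _) => [k|k] //=; lia.
have /= -> := hh' j; rewrite -[RHS]/(icoef _ (Posz j)) icoef_sum.
under eq_bigr => i _ do rewrite icoefZ icoefXn.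
case E: (N%:Z - j%:Z) => [k|k] /=; last first.
  rewrite big1 // => i _; have il := ltn_ord i.
  by rewrite (_ : (_ == _) = false) ?mulr0 //; lia.
have kN : (k < N.+1)%N by lia.
rewrite (bigD1 (Ordinal kN)) //= big1 ?addr0 => [|i].
  by rewrite (_ : (_ == _) = true) ?mulr1 //; lia.
rewrite -val_eqE /= => ij; have il := ltn_ord i.
by rewrite (_ : (_ == _) = false) ?mulr0 //; lia.
Qed.

Lemma revpM a b h h' g g' :
  revp a h h' -> revp b g g' -> revp (a + b) (h * g) (h' * g').
Proof.
move=> /revpP [hE h'E] /revpP [gE g'E] k.
rewrite [X in icoef (X * _) _ = _]h'E [X in icoef (_ * X) _ = _]g'E.
rewrite [X in _ = icoef (X * _) _]hE [X in _ = icoef (_ * X) _]gE.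
rewrite !mulr_suml !icoef_sum; apply: eq_bigr => i _.
rewrite !mulr_sumr !icoef_sum; apply: eq_bigr => j _.
rewrite -!scalerAl -!scalerAr !icoefZ -!exprD !icoefXn.
have il := ltn_ord i; have jl := ltn_ord j.
by do 2 congr (_ * _); congr (nat_of_bool _)%:R; lia.
Qed.

Lemma flip_revp F F' m : flip F F' -> revp (m + m) (F m) (F' m).
Proof.
move=> f k; have /fpsP /(_ m) /= := f (k - m%:Z).
by rewrite addrC subrK => ->; congr icoef; lia.
Qed.

Lemma revp_flip (F F' : lser) : (forall m, revp (m + m) (F m) (F' m)) -> flip F F'.
Proof. by move=> f d; apply/fpsP => m /=; rewrite f; congr icoef; lia. Qed.

Lemma flipM F F' G G' : flip F F' -> flip G G' -> flip (F * G) (F' * G').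
Proof.
move=> f g; apply: revp_flip => m k; rewrite !pser_coefM !icoef_sum.
apply: eq_bigr => i _.
have := revpM (flip_revp i f) (flip_revp (m - i) g) k.
have il := ltn_ord i; rewrite (_ : (i + i + (m - i + (m - i)) = m + m)%N) //; lia.
Qed.

Lemma flip1 : flip 1 1.
Proof. by move=> d; rewrite -(rmorph1 liota) !cf_liota oppr_eq0. Qed.

Lemma flipX F F' n : flip F F' -> flip (F ^+ n) (F' ^+ n).
Proof.
by move=> f; elim: n => [|n IHn]; rewrite ?expr0 ?exprS; [apply: flip1|apply: flipM].
Qed.

(** * Products of series of nonnegative y-degree *)

Definition pos (G : lser) := forall d : int, d < 0 -> cf G d = 0.
Definition bounded (G : lser) := forall (d : int) m, m%:Z < d -> cf G d m = 0.

Lemma flip_bounded F F' : flip F F' -> bounded F'.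
Proof.
move=> f d m md; rewrite f /=.
by case E: (_ - _) => [k|k] //=; lia.
Qed.

(** In row m only the y-degrees 0 to m of G contribute, so the convolution over all integers reduces
    to a finite sum, with any cutoff K > m. *)
Lemma cfM_pos F G d m K : pos G -> bounded G -> (m < K)%N ->
  cf (F * G) d m = (\sum_(k < K) cf F (d - k%:Z) * cf G k%:Z) m.
Proof.
move=> posG bG mK; rewrite mulrC cfE pser_coefM icoef_sum fps_coef_sum.
under [RHS]eq_bigr => k _ do rewrite mulrC fps_coefM.
rewrite exchange_big; apply: eq_bigr => i _ /=.
have Gi : G i = \sum_(k < K) cf G k i *: 'X^(i + k).
  apply/polyP => j; rewrite -[LHS]/(icoef (G i) (Posz j)).
  rewrite -[RHS]/(icoef _ (Posz j)) icoef_sum.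
  under eq_bigr => k _ do rewrite icoefZ icoefXn.
  have -> : icoef (G i) j = cf G (j%:Z - i%:Z) i.
    by rewrite cfE addrC subrK.
  case E: (j%:Z - i%:Z) => [l|l]; last first.
    rewrite posG ?fps_coef0 ?big1 // => k _.
    by rewrite (_ : (_ == _) = false) ?mulr0 //; lia.
  have [lK|lK] := ltnP l K; last first.
    rewrite bG; last by case: i E => /= i ?; lia.
    rewrite big1 // => k _.
    by rewrite (_ : (_ == _) = false) ?mulr0 //; case: k => /= k; lia.
  rewrite (bigD1 (Ordinal lK)) //= big1 ?addr0 => [|k].
    by rewrite (_ : (_ == _) = true) ?mulr1 //; lia.
  rewrite -val_eqE /= => kl.
  by rewrite (_ : (_ == _) = false) ?mulr0 //; lia.
rewrite [in LHS]Gi mulr_suml icoef_sum; apply: eq_bigr => k _.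
rewrite -scalerAl icoefZ icoefXnM; congr (_ * icoef _ _).
by case: i {Gi} => /= i; lia.
Qed.

Lemma posM F G : pos F -> pos G -> bounded G -> pos (F * G).
Proof.
move=> pF pG bG d d0; apply/fpsP => m; rewrite (cfM_pos _ _ pG bG (ltnSn m)).
by rewrite big1 // => k _; rewrite pF ?mul0r //; lia.
Qed.

(** When F also has no negative degrees, the degrees of G above n contribute nothing; the cutoff
    then no longer depends on the row, and the identity holds between series. *)
Lemma cfM_pos_nat F G (n : nat) : pos F -> pos G -> bounded G ->
  cf (F * G) n = \sum_(k < n.+1) cf F (n%:Z - k%:Z) * cf G k%:Z.
Proof.
move=> pF pG bG; apply/fpsP => m.
rewrite (@cfM_pos _ _ _ _ (n.+1 + m.+1)%N) //; last by lia.
congr (fps_coef _ m); rewrite big_split_ord /= [X in _ + X]big1 ?addr0 // => k _.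
by rewrite pF ?mul0r //=; lia.
Qed.

(** * Polynomial expressions in H1, H2 and sqrt (1 - 4 t) *)

(** The index d bounds the degree, and r tells whether sqrt (1 - 4 t) may be used. An inductive
    closure postpones multivariate polynomials to a final conversion. *)
Inductive expressible (r : bool) : nat -> laurent -> Prop :=
| expr_laurent d b : laurent_polynomial b -> expressible r d b
| expr_H1 : expressible r 2 H1
| expr_H2 : expressible r 2 H2
| expr_sqrt : r -> expressible r 1 sqrt14t
| expr_add d b c :
    expressible r d b -> expressible r d c -> expressible r d (b + c)
| expr_mul d e b c :
    expressible r d b -> expressible r e c -> expressible r (d + e) (b * c)
| expr_le d e b : (d <= e)%N -> expressible r d b -> expressible r e b.

Lemma expressible_sqrt r d b : expressible false d b -> expressible r d b.
Proof.
elim=> {d b} [d b lb|||//|d b c _ IHb _ IHc|d e b c _ IHb _ IHc|d e b de _].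
- exact: expr_laurent.
- exact: expr_H1.
- exact: expr_H2.
- exact: expr_add.
- exact: expr_mul.
- exact: expr_le.
Qed.

Lemma fps_polyE p n : fps_of_poly p n = p`_n.
Proof. by []. Qed.

Lemma fps_of_polyM p q : fps_of_poly (p * q) = fps_of_poly p * fps_of_poly q.
Proof. by apply/fpsP => n; rewrite fps_coefM /= coefM. Qed.
Lemma fps_of_polyD p q : fps_of_poly (p + q) = fps_of_poly p + fps_of_poly q.
Proof. by apply/fpsP => n; rewrite fps_coefD /= coefD. Qed.
Lemma fps_of_polyXn n : fps_of_poly 'X^n = fps_t ^+ n.
Proof. by elim: n => // n IHn; rewrite !exprS fps_of_polyM IHn. Qed.

Definition fpsC (c : rat) : fps := fps_of_poly c%:P.

Lemma fps_coef_CM c (f : fps) n : (fpsC c * f) n = c * f n.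
Proof.
rewrite fps_coefM big_ord_recl /= coefC subn0 big1 ?addr0 // => i _.
by rewrite coefC mul0r.
Qed.

Fact fpsC_is_zmod_morphism : zmod_morphism fpsC.
Proof. by move=> a b; apply/fpsP => n; rewrite /fpsC polyCB /= coefB. Qed.
HB.instance Definition _ :=
  GRing.isZmodMorphism.Build rat fps fpsC fpsC_is_zmod_morphism.
Fact fpsC_is_monoid_morphism : monoid_morphism fpsC.
Proof. by split=> // a b; rewrite /fpsC polyCM fps_of_polyM. Qed.
HB.instance Definition _ :=
  GRing.isMonoidMorphism.Build rat fps fpsC fpsC_is_monoid_morphism.

Lemma laurent_t_neq0 : laurent_t != 0.
Proof.
rewrite tofrac_eq0; apply/eqP => /fpsP /(_ 1%N) /=.
by rewrite coefX coef0.
Qed.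

Lemma laurent_polynomial_poly p : laurent_polynomial (laurent_of (fps_of_poly p)).
Proof. by exists p, 0%N; rewrite expr0 divr1. Qed.

Lemma laurent_polynomial_nat k : laurent_polynomial k%:R.
Proof.
have -> : k%:R = laurent_of (fpsC k%:R) by rewrite !rmorph_nat.
exact: laurent_polynomial_poly.
Qed.

Lemma laurent_polynomialV n : laurent_polynomial (laurent_t ^- n).
Proof. by exists 1, n; rewrite tofrac1 mul1r. Qed.

Lemma laurent_polynomialM b c : laurent_polynomial b -> laurent_polynomial c ->
  laurent_polynomial (b * c).
Proof.
move=> [p [m ->]] [q [n ->]]; exists (p * q), (m + n)%N.
by rewrite fps_of_polyM tofracM exprD invfM mulrACA.
Qed.

Lemma laurent_polynomialD b c : laurent_polynomial b -> laurent_polynomial c ->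
  laurent_polynomial (b + c).
Proof.
move=> [p [m ->]] [q [n ->]]; exists ('X^n * p + 'X^m * q), (m + n)%N.
have t0 k : laurent_t ^+ k != 0 by rewrite expf_neq0 // laurent_t_neq0.
rewrite fps_of_polyD !fps_of_polyM !fps_of_polyXn tofracD !tofracM !tofracXn.
by rewrite addf_div // exprD; congr (_ / _); congr (_ + _); apply: mulrC.
Qed.

(** Coefficients of powers of y never involve sqrt (1 - 4 t), which only appears on setting y =
    1. *)
Definition scal (d : nat) (a : fps) := expressible false d (laurent_of a).

Lemma scalD d a b : scal d a -> scal d b -> scal d (a + b).
Proof. by rewrite /scal tofracD; apply: expr_add. Qed.
Lemma scalM d e a b : scal d a -> scal e b -> scal (d + e) (a * b).
Proof. by rewrite /scal tofracM; apply: expr_mul. Qed.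
Lemma scal_le d e a : (d <= e)%N -> scal d a -> scal e a.
Proof. exact: expr_le. Qed.
Lemma scal_poly d p : scal d (fps_of_poly p).
Proof. exact/expr_laurent/laurent_polynomial_poly. Qed.
Lemma scalC d c : scal d (fpsC c).
Proof. exact: scal_poly. Qed.
Lemma scal_t d : scal d fps_t.
Proof. exact: scal_poly. Qed.
Lemma scal_tX d n : scal d (fps_t ^+ n).
Proof. by rewrite -fps_of_polyXn; apply: scal_poly. Qed.
Lemma scal0 d : scal d 0.
Proof. exact: scal_poly. Qed.
Lemma scal1 d : scal d 1.
Proof. exact: scal_poly. Qed.
Lemma scalCM d c a : scal d a -> scal d (fpsC c * a).
Proof. exact: (@scalM 0 d _ _ (scalC 0 c)). Qed.
Lemma scaltM d a : scal d a -> scal d (fps_t * a).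
Proof. exact: (@scalM 0 d _ _ (scal_t 0)). Qed.
Lemma scalN d a : scal d a -> scal d (- a).
Proof. by move/(scalCM (-1)); rewrite rmorphN1 mulN1r. Qed.
Lemma scalB d a b : scal d a -> scal d b -> scal d (a - b).
Proof. by move=> Aa /scalN; apply: scalD. Qed.
Lemma scal_sum d (I : finType) (F : I -> fps) :
  (forall i, scal d (F i)) -> scal d (\sum_i F i).
Proof. by move=> AF; elim/big_ind: _ => // *; [apply: scal0|apply: scalD]. Qed.

Lemma expressible_tXM r d n (a : fps) :
  expressible r d (laurent_of (fps_t ^+ n * a)) -> expressible r d (laurent_of a).
Proof.
move=> Aa; rewrite -[d]add0n.
have -> : laurent_of a = laurent_t ^- n * laurent_of (fps_t ^+ n * a).
  by rewrite tofracM tofracXn mulKf // expf_neq0 // laurent_t_neq0.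
by apply: expr_mul Aa; apply/expr_laurent/laurent_polynomialV.
Qed.

Lemma scal_tMK d a : scal d (fps_t * a) -> scal d a.
Proof. exact: (@expressible_tXM false d 1 a). Qed.

(** * The square roots of 1 - 4 q and 1 - 4 p *)

Local Arguments fps_sqrt14t : simpl never.

(** The binomial series of sqrt (1 - 4 q); in [sq2], q is replaced with p, and p^m = q^m y^(2 m). *)
Definition sq1 : lser := PSer (fun m => (fps_sqrt14t m)%:P).
Definition sq2 : lser := PSer (fun m => fps_sqrt14t m *: 'X^(m + m)).

Lemma flip_sq1 : flip sq1 sq2.
Proof.
move=> d; apply/fpsP => m; rewrite !cfE.
have -> : sq1 m = fps_sqrt14t m *: 'X^0 by rewrite expr0 alg_polyC.
rewrite !icoefZ !icoefXn.
by congr (_ * (nat_of_bool _)%:R); lia.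
Qed.

Lemma sq1_sqr : sq1 ^+ 2 = 1 - 4%:R * lq.
Proof.
apply/pserP => m; rewrite expr2 pser_coefM.
have -> : \sum_(i < m.+1) sq1 i * sq1 (m - i)%N = ((fps_sqrt14t ^+ 2) m)%:P.
  by rewrite expr2 fps_coefM rmorph_sum; apply: eq_bigr => i _; rewrite rmorphM.
rewrite fps_sqrt14t_sqr pser_coefD pser_coefN pser_coef1.
have -> : (4%:R * lq) m = (4 * (m == 1%N)%:R)%:P.
  rewrite mulr_natl; elim: 4%N => [|k IHk].
    by rewrite mulr0n pser_coef0 mul0r.
  rewrite mulrS pser_coefD IHk -natr1 mulrDl mul1r addrC polyCD.
  by rewrite /=; case: eqP.
rewrite /= coefB coefZ coefX coef1 polyCB; congr (_ - _).
by case: m => [|m]; rewrite ?polyC0 ?polyC1.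
Qed.

Lemma sq2_sqr : sq2 ^+ 2 = 1 - 4%:R * lp.
Proof.
have := flipX 2 flip_sq1; rewrite sq1_sqr => /flip_uniq; apply.
have -> : 4%:R = liota (4%:R) :> lser by rewrite rmorph_nat.
move=> d; rewrite !cfB !cf_liotaM flip1 -[lp]mulr1 -[lq]mulr1.
by rewrite (flip_lqM flip1).
Qed.

Definition lw : lser := sq1 * sq2.

Lemma flip_lw : flip lw lw.
Proof.
by rewrite {2}/lw mulrC; apply: flipM flip_sq1 _; apply: flip_sym flip_sq1.
Qed.

Definition om (n : nat) : fps := cf lw n.

Lemma om_coef n m : om n m = 
  if (n <= m)%N && ~~ odd (m - n) then
    fps_sqrt14t (m - n)./2 * fps_sqrt14t (n + (m - n)./2)%N else 0.
Proof.
rewrite /om /lw mulrC cfE pser_coefM icoef_sum.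
have sE (i : 'I_m.+1) : sq2 i * sq1 (m - i)%N =
    (fps_sqrt14t (m - i)%N * fps_sqrt14t i) *: 'X^(i + i).
  by rewrite [LHS]mulrC mul_polyC scalerA.
under eq_bigr => i _ do rewrite sE icoefZ icoefXn.
case: ifP => [/andP [nm odd_mn]|nodd].
  have km : (n + (m - n)./2 < m.+1)%N by lia.
  rewrite (bigD1 (Ordinal km)) //= big1 ?addr0 => [|i].
    rewrite (_ : (_ == _) = true) ?mulr1 /=; last by lia.
    by congr (fps_sqrt14t _ * _); lia.
  rewrite -val_eqE /= => ik.
  by rewrite (_ : (_ == _) = false) ?mulr0 //; lia.
rewrite big1 // => i _; have il := ltn_ord i.
by rewrite (_ : (_ == _) = false) ?mulr0 //; lia.
Qed.

(** The coefficients are squares of binomial ones, ((-1/2)_k 4^k / k!)^2, and (1)_k = k!. *)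
Lemma om0 : laurent_of (om 0) = H1.
Proof.
congr laurent_of; apply/fpsP => m; rewrite om_coef /= subn0 add0n.
case: ifP; case: (odd m) => //= _.
rewrite /hyp2F1_coef; have -> : rising 1 m./2 = m./2`!%:R.
  elim: m./2 => [|k IHk]; first by rewrite /rising big_ord0.
  by rewrite /rising big_ord_recr /= [X in X * _]IHk factS natrM nat1r mulrC.
have : m./2`!%:R != 0 :> rat by rewrite pnatr_eq0 -lt0n fact_gt0.
rewrite (_ : 16 = 4 * 4 :> rat) ?exprMn; last by ring.
by move: (m./2`!%:R) => f f0; field.
Qed.

(** Consecutive binomial coefficients are multiplied; (-1/2)_(k + 1) = - (1/2)_k / 2 and (2)_k = (k
    + 1)! turn the product into a coefficient of H2. *)
Lemma om1 : om 1 = - (fpsC 2 * (fps_t * hyp2F1_16t2 (- 2^-1) 2^-1 2)).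
Proof.
apply/fpsP => m; rewrite om_coef fps_coefN fps_coef_CM fps_coef_tM.
case: m => [|m]; first by rewrite mulr0 oppr0.
rewrite /= subSS subn0 add1n; case: (odd m) => /=; first by rewrite mulr0 oppr0.
set k := m./2; rewrite /hyp2F1_coef.
have -> : rising 2 k = k.+1`!%:R.
  elim: k => [|k IHk]; first by rewrite /rising big_ord0.
  rewrite /rising big_ord_recr /= [X in X * _]IHk [in RHS]factS natrM mulrC.
  by rewrite -natrD.
have -> : rising (- 2^-1) k.+1 = - 2^-1 * rising 2^-1 k.
  rewrite /rising big_ord_recl addr0; congr (_ * _); apply: eq_bigr => i _.
  by rewrite /= /bump add1n -natr1; field.
rewrite (_ : 16 = 4 * 4 :> rat) ?exprMn; last by ring.
have : k`!%:R != 0 :> rat by rewrite pnatr_eq0 -lt0n fact_gt0.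
have : k.+1`!%:R != 0 :> rat by rewrite pnatr_eq0 -lt0n fact_gt0.
by move: (k`!%:R) (k.+1`!%:R) => f g g0 f0; rewrite exprS; field; rewrite f0 g0.
Qed.

(* Coefficients in y of the identity lw^2 D(lw) = lw D(lw^2) / 2 for the
   derivation D = y d/dy. *)
Lemma om_rec n : fpsC (4 * n%:R + 10) * (fps_t * om n.+2) =
  fpsC n.+1%:R * (om n.+1 + fpsC 16 * (fps_t * (fps_t * om n.+1))) -
  fpsC (4 * n%:R - 2) * (fps_t * om n).
Proof.
apply/fpsP => m.
rewrite fps_coefD fps_coefN !fps_coef_CM fps_coefD fps_coef_CM !fps_coef_tM.
case: m => [|m]; first by rewrite om_coef /=; ring.
rewrite fps_coef_tM.
have srec k : fps_sqrt14t k.+1 = (4 * k%:R - 2) / k.+1%:R * fps_sqrt14t k.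
  by rewrite mulrAC -fps_sqrt14t_rec [RHS]mulrC mulKf // pnatr_eq0.
have k0 k : k.+1%:R != 0 :> rat by rewrite pnatr_eq0.
rewrite !om_coef.
have [mn|] := boolP (m < n)%N.
  rewrite !ifF; do ?[by lia].
  case: m mn => [|m] mn; first by field.
  by rewrite om_coef ifF; [field|lia].
rewrite -leqNgt => nm; have [odd_mn|even_mn] := boolP (odd (m - n)).
  rewrite !ifF; do ?[by lia].
  case: m nm odd_mn => [|m] nm odd_mn; first by field.
  by rewrite om_coef ifF; [field|lia].
have [j mE] : exists j, m = (n + j.*2)%N by exists (m - n)./2; lia.
rewrite !andbT ltnS nm.
have -> : (m.+1 - n.+1)./2 = j by lia.
case: j mE => [|j] mE.
  rewrite ifF; last by lia.
  have -> : (if m is m'.+1 then om n.+1 m' else 0) = 0.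
    by case: m mE {nm even_mn} => // m mE; rewrite om_coef ifF //; lia.
  rewrite !addn0 (srec n); have := k0 n; rewrite -natr1.
  by move: (n%:R) (fps_sqrt14t n) (fps_sqrt14t 0%N) => x a b x0; field.
rewrite ifT; last by lia.
have -> : (m - n.+2)./2 = j by lia.
case: m mE {nm even_mn} => [|m] mE; first by lia.
rewrite om_coef ifT; last by lia.
have -> : (m - n.+1)./2 = j by lia.
have -> : (n.+2 + j = (n + j).+2)%N by lia.
have -> : (n.+1 + j.+1 = (n + j).+2)%N by lia.
have -> : (n + j.+1 = (n + j).+1)%N by lia.
have -> : (n.+1 + j = (n + j).+1)%N by lia.
rewrite (srec (n + j).+1) (srec j).
have := k0 (n + j).+1; have := k0 j.
rewrite -!natr1 natrD.
move: (fps_sqrt14t _) (fps_sqrt14t _) (n%:R) (j%:R) => a b x y.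
by move=> y0 xy0; field; rewrite y0 xy0.
Qed.

(** The recurrence is solved for [om n.+2]: 4 n + 10 is nonzero and division by t does not change
    the degree. *)
Lemma scal_om n : scal 2 (om n).
Proof.
suff: scal 2 (om n) /\ scal 2 (om n.+1) by case.
elim: n => [|n [IHn IHn1]]; split=> //.
- by rewrite /scal om0; apply: expr_H1.
- by rewrite om1; apply/scalN/scalCM/scaltM/expr_H2.
- have c0 : 4 * n%:R + 10 != 0 :> rat by rewrite -natrM -natrD pnatr_eq0 addn_eq0 andbF.
  have /(congr1 ( *%R (fpsC (4 * n%:R + 10)^-1))) := om_rec n.
  rewrite mulrA -rmorphM mulVf // rmorph1 mul1r => om_eq.
  apply: scal_tMK; rewrite om_eq.
  apply/scalCM/scalB; apply/scalCM; last exact: scaltM.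
  by apply/scalD => //; apply/scalCM; do 2 apply: scaltM.
Qed.

(** * The filtered algebra generated by the one-sided parts of lw *)

Definition wneg : lser := npart lw - liota (om 0).
Definition wpos : lser := lw - npart lw.

Lemma lw_split : lw = wneg + liota (om 0) + wpos.
Proof. by rewrite /wneg /wpos subrK addrC subrK. Qed.

Lemma cf_wpos d : cf wpos d = if 0 < d then cf lw d else 0.
Proof. by rewrite cfB cf_npart; case: ltgtP; rewrite ?subr0 ?subrr. Qed.

Lemma flip_wpos : flip wpos wneg.
Proof.
move=> d; rewrite cf_wpos cfB cf_npart cf_liota oppr_gt0.
case: ltgtP => [d0|d0|->]; rewrite ?subr0 ?subrr //.
by rewrite flip_lw.
Qed.

Definition bpos (e : bool) k : lser := sq2 ^+ e * wpos ^+ k.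
Definition bneg (e : bool) k : lser := sq1 ^+ e * wneg ^+ k.

(** The filtered span of the one-sided products: scalars add their degree, while p and q cost
    nothing. Closure under products is not built in; it is [quasiM]. *)
Inductive quasi : nat -> lser -> Prop :=
| quasi_bpos (e : bool) k : quasi (e + k.*2) (bpos e k)
| quasi_bneg (e : bool) k : quasi (e + k.*2) (bneg e k)
| quasi_add d F G : quasi d F -> quasi d G -> quasi d (F + G)
| quasi_lp d G : quasi d G -> quasi d (lp * G)
| quasi_lq d G : quasi d G -> quasi d (lq * G)
| quasi_scal d e a G : scal d a -> quasi e G -> quasi (d + e) (liota a * G)
| quasi_le d e G : (d <= e)%N -> quasi d G -> quasi e G.

Lemma quasi_scalM d e a G : (d <= e)%N -> scal d a -> quasi (e - d) G ->
  quasi e (liota a * G).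
Proof. by move=> de Aa /(quasi_scal Aa); rewrite subnKC. Qed.

Lemma quasi_CM d c G : quasi d G -> quasi d (liota (fpsC c) * G).
Proof. exact: (@quasi_scal 0 d _ _ (scalC 0 c)). Qed.

Lemma quasiN d G : quasi d G -> quasi d (- G).
Proof. by move/(quasi_CM (-1)); rewrite !rmorphN1 mulN1r. Qed.

Lemma quasiB d F G : quasi d F -> quasi d G -> quasi d (F - G).
Proof. by move=> QF /quasiN; apply: quasi_add. Qed.

Lemma quasi_natM d n G : quasi d G -> quasi d (n%:R * G).
Proof. by move/(quasi_CM n%:R); rewrite !rmorph_nat. Qed.

Lemma quasi1 d : quasi d 1.
Proof.
apply: (@quasi_le 0) => //.
by have := quasi_bpos false 0; rewrite /bpos !expr0 mulr1.
Qed.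

Lemma quasi_liota d a : scal d a -> quasi d (liota a).
Proof.
by move=> Aa; rewrite -[liota a]mulr1 -[d]addn0; apply: quasi_scal => //; apply: quasi1.
Qed.

Lemma quasi_sub14lp d G : quasi d G -> quasi d ((1 - 4%:R * lp) * G).
Proof.
move=> QG; rewrite mulrBl mul1r -mulrA; apply: quasiB => //.
exact/quasi_natM/quasi_lp.
Qed.

Lemma quasi_sub14lq d G : quasi d G -> quasi d ((1 - 4%:R * lq) * G).
Proof.
move=> QG; rewrite mulrBl mul1r -mulrA; apply: quasiB => //.
exact/quasi_natM/quasi_lq.
Qed.

(** The generators come in mirror pairs, as do p and q, so the mirror image always exists here. *)
Lemma quasi_flip d G : quasi d G -> exists2 G', flip G G' & quasi d G'.
Proof.
elim=> {d G}.
- move=> e k; exists (bneg e k); last exact: quasi_bneg.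
  by apply: flipM; apply: flipX; [apply: flip_sym flip_sq1|apply: flip_wpos].
- move=> e k; exists (bpos e k); last exact: quasi_bpos.
  by apply: flipM; apply: flipX; [apply: flip_sq1|apply: flip_sym flip_wpos].
- move=> d F G _ [F' fF QF] _ [G' fG QG]; exists (F' + G'); first exact: flipD.
  exact: quasi_add.
- move=> d G _ [G' fG QG]; exists (lq * G'); first exact: flip_lpM.
  exact: quasi_lq.
- move=> d G _ [G' fG QG]; exists (lp * G'); first exact: flip_lqM.
  exact: quasi_lp.
- move=> d e a G Aa _ [G' fG QG]; exists (liota a * G'); first exact: flip_liotaM.
  exact: quasi_scal.
- by move=> d e G de _ [G' fG QG]; exists G' => //; apply: quasi_le QG.
Qed.

(* A sequence whose second differences are small is, up to small terms, an
   affine interpolation of its end points. *)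
Lemma interpolate (S : lser -> Prop) (f : nat -> lser) n :
  (forall F G, S F -> S G -> S (F + G)) ->
  (forall c F, S F -> S (liota (fpsC c) * F)) ->
  S (f 0) -> S (f n) ->
  (forall k, (k.+1 < n)%N -> S (f k.+2 - f k.+1 *+ 2 + f k)) ->
  forall k, (k <= n)%N -> S (f k).
Proof.
move=> SD SC S0 Sn S2.
have SN F : S F -> S (- F) by move/(SC (-1)); rewrite !rmorphN1 mulN1r.
have SB F G : S F -> S G -> S (F - G) by move=> SF /SN; apply: SD.
have S00 : S 0 by rewrite -(subrr (f 0)); apply: SB.
case: n Sn S2 => [|n] Sn S2 k; first by rewrite leqn0 => /eqP ->.
pose D k : lser := f k.+1 - f k.
have SDD j : (j <= n)%N -> S (D j - D 0).
  elim: j => [|j IHj] jn; first by rewrite subrr.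
  rewrite -(subrK (D j) (D j.+1)) -addrA; apply: SD; last exact/IHj/ltnW.
  have := S2 j jn; congr S; rewrite /D; ring.
have Sf j : (j <= n.+1)%N -> S (f j - f 0 - D 0 *+ j).
  elim: j => [|j IHj] jn; first by rewrite subrr mulr0n subr0.
  have -> : f j.+1 - f 0 - D 0 *+ j.+1 = (D j - D 0) + (f j - f 0 - D 0 *+ j).
    by rewrite mulrSr /D; ring.
  by apply: SD; [apply: SDD|apply/IHj/ltnW].
have SD0 : S (D 0).
  have -> : D 0 = liota (fpsC n.+1%:R^-1) * (D 0 *+ n.+1).
    have nE : n.+1%:R = liota (fpsC n.+1%:R) by rewrite !rmorph_nat.
    rewrite -(mulr_natl (D 0)) nE mulrA -!rmorphM.
    by rewrite mulVf ?rmorph1 ?mul1r // pnatr_eq0.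
  apply: SC; have -> : D 0 *+ n.+1 = (f n.+1 - f 0) - (f n.+1 - f 0 - D 0 *+ n.+1).
    by rewrite opprB addrC subrK.
  exact: SB (SB _ _ Sn S0) (Sf _ (leqnn _)).
move=> kn; have -> : f k = (f k - f 0 - D 0 *+ k) + (f 0 + D 0 *+ k) by ring.
apply: (SD _ _ (Sf _ kn)); apply: (SD _ _ S0).
elim: k {kn} => [|k IHk]; first by rewrite mulr0n.
by rewrite mulrS; apply: SD.
Qed.

Lemma lw_sqr : lw ^+ 2 = (1 - 4%:R * lq) * (1 - 4%:R * lp).
Proof. by rewrite /lw exprMn sq1_sqr sq2_sqr. Qed.

(** Let f_j = (-1)^j w-^j w+^(n - j). Its end points are generators up to sign, and its second
    differences are, up to sign, w-^j w+^(n - j - 2) (w- + w+)^2. As (w- + w+)^2 = w^2 - 2 H1 (w- +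
    w+) - H1^2 and w^2 is a polynomial in p and q, only products with fewer than n factors remain,
    which the strong induction covers; [interpolate] concludes. *)
Lemma quasi_wneg_wpos k l : quasi (k + l).*2 (wneg ^+ k * wpos ^+ l).
Proof.
move: {2}(k + l)%N (erefl (k + l)%N) => n.
elim/ltn_ind: n k l => n IHn k l kln; rewrite kln.
pose f j := (- 1) ^+ j * (wneg ^+ j * wpos ^+ (n - j)).
suff: forall j, (j <= n)%N -> quasi n.*2 (f j).
  move/(_ k); rewrite -kln leq_addr => /(_ isT).
  rewrite /f kln (_ : (n - k)%N = l); last by lia.
  by rewrite -signr_odd; case: odd; rewrite ?mul1r // mulN1r => /quasiN; rewrite opprK.
apply: interpolate => //.
- by move=> F G; apply: quasi_add.
- by move=> c F; apply: quasi_CM.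
- rewrite /f !expr0 !mul1r subn0.
  by have := quasi_bpos false n; rewrite /bpos mul1r.
- rewrite /f subnn -signr_odd mulr1.
  have := quasi_bneg false n; rewrite /bneg mul1r add0n => Q.
  by case: odd; rewrite ?mul1r // mulN1r; apply: quasiN.
move=> j jn; rewrite /f.
have [l' nE] : exists l', n = (j + l').+2 by exists (n - j.+2)%N; lia.
have -> : (n - j.+2 = l')%N by lia.
have -> : (n - j.+1 = l'.+1)%N by lia.
have -> : (n - j = l'.+2)%N by lia.
have -> : (-1) ^+ j.+2 * (wneg ^+ j.+2 * wpos ^+ l')
  - (-1) ^+ j.+1 * (wneg ^+ j.+1 * wpos ^+ l'.+1) *+ 2
  + (-1) ^+ j * (wneg ^+ j * wpos ^+ l'.+2)
  = (-1) ^+ j * (wneg ^+ j * wpos ^+ l' * (wneg + wpos) ^+ 2).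
  by rewrite !exprS expr0; ring.
have -> : (wneg + wpos) ^+ 2 = lw ^+ 2 -
    (liota (om 0) * (wneg + wpos) *+ 2 + liota (om 0) ^+ 2).
  by rewrite lw_split; ring.
set X := (X in _ * X); have QX : quasi n.*2 X; last first.
  by rewrite -signr_odd; case: odd; rewrite ?mul1r // mulN1r; apply: quasiN.
have Qjl a b : (a + b < n)%N -> quasi (a + b).*2 (wneg ^+ a * wpos ^+ b).
  by move=> abn; apply: (IHn (a + b)%N).
rewrite /X lw_sqr.
have -> : wneg ^+ j * wpos ^+ l' * ((1 - 4%:R * lq) * (1 - 4%:R * lp) -
   (liota (om 0) * (wneg + wpos) *+ 2 + liota (om 0) ^+ 2)) =
  (1 - 4%:R * lq) * ((1 - 4%:R * lp) * (wneg ^+ j * wpos ^+ l')) -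
  (liota (om 0) * (wneg ^+ j.+1 * wpos ^+ l' + wneg ^+ j * wpos ^+ l'.+1) *+ 2 +
   liota (om 0) * (liota (om 0) * (wneg ^+ j * wpos ^+ l'))).
  by rewrite !exprS; ring.
apply: quasiB; last apply: quasi_add.
- apply/quasi_sub14lq/quasi_sub14lp; apply: quasi_le (Qjl _ _ _); lia.
- rewrite mulr2n; suff Q : quasi n.*2 (liota (om 0) *
      (wneg ^+ j.+1 * wpos ^+ l' + wneg ^+ j * wpos ^+ l'.+1)).
    exact: quasi_add.
  apply: (quasi_scalM _ (scal_om 0)); first by lia.
  by apply: quasi_add; apply: quasi_le (Qjl _ _ _); lia.
- do 2 (apply: (quasi_scalM _ (scal_om 0)); first by lia).
  apply: quasi_le (Qjl _ _ _); lia.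
Qed.

Lemma sq1_lw : sq1 * lw = (1 - 4%:R * lq) * sq2.
Proof. by rewrite /lw mulrA -expr2 sq1_sqr. Qed.
Lemma sq2_lw : sq2 * lw = (1 - 4%:R * lp) * sq1.
Proof. by rewrite /lw mulrCA -expr2 sq2_sqr mulrC. Qed.

(** Expanding w = w- + H1 + w+ in s1 w = (1 - 4 q) s2 trades a factor w+ next to s1 for w-, up to
    terms with fewer factors; repeating this ends at a generator. For s2 the roles are exchanged.
    The two claims share one strong induction, since each reduction introduces the other root. *)
Lemma quasi_sq_wneg_wpos k l :
  quasi (k + l).*2.+1 (sq1 * (wneg ^+ k * wpos ^+ l)) /\
  quasi (k + l).*2.+1 (sq2 * (wneg ^+ k * wpos ^+ l)).
Proof.
move: {2}(k + l)%N (erefl (k + l)%N) => n.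
elim/ltn_ind: n k l => n IHn k l kln; rewrite kln.
have IH1 a b : (a + b < n)%N -> quasi (a + b).*2.+1 (sq1 * (wneg ^+ a * wpos ^+ b)).
  by move=> abn; case: (IHn _ abn a b).
have IH2 a b : (a + b < n)%N -> quasi (a + b).*2.+1 (sq2 * (wneg ^+ a * wpos ^+ b)).
  by move=> abn; case: (IHn _ abn a b).
split.
  elim: l k kln => [|l IHl] k kln.
    rewrite mulr1; have := quasi_bneg true k.
    by rewrite /bneg expr1 add1n -kln addn0.
  have -> : sq1 * (wneg ^+ k * wpos ^+ l.+1) =
    (sq1 * lw) * (wneg ^+ k * wpos ^+ l) -
    sq1 * (wneg ^+ k.+1 * wpos ^+ l) -
    liota (om 0) * (sq1 * (wneg ^+ k * wpos ^+ l)).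
    by rewrite lw_split !exprS; ring.
  rewrite sq1_lw -mulrA; apply: quasiB; first apply: quasiB.
  - apply/quasi_sub14lq; apply: quasi_le (IH2 _ _ _); lia.
  - by apply: IHl; lia.
  - apply: (quasi_scalM _ (scal_om 0)); first by lia.
    by apply: quasi_le (IH1 _ _ _); lia.
elim: k l kln => [|k IHk] l kln.
  rewrite mul1r; have := quasi_bpos true l.
  by rewrite /bpos expr1 add1n -kln.
have -> : sq2 * (wneg ^+ k.+1 * wpos ^+ l) =
  (sq2 * lw) * (wneg ^+ k * wpos ^+ l) -
  sq2 * (wneg ^+ k * wpos ^+ l.+1) -
  liota (om 0) * (sq2 * (wneg ^+ k * wpos ^+ l)).
  by rewrite lw_split !exprS; ring.
rewrite sq2_lw -mulrA; apply: quasiB; first apply: quasiB.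
- apply/quasi_sub14lp; apply: quasi_le (IH1 _ _ _); lia.
- by apply: IHk; lia.
- apply: (quasi_scalM _ (scal_om 0)); first by lia.
  by apply: quasi_le (IH2 _ _ _); lia.
Qed.

(** A product of two generators has exponents at most 2 in s1 and s2. The squares are polynomials in
    q and p, and s1 s2 = w splits into its three parts. *)
Lemma quasi_monomial (a b k l : nat) : (a <= 2)%N -> (b <= 2)%N ->
  quasi (a + b + (k + l).*2) (sq1 ^+ a * sq2 ^+ b * (wneg ^+ k * wpos ^+ l)).
Proof.
have red1 c G : quasi c G -> quasi c.+2 (sq1 ^+ 2 * G).
  by move=> QG; rewrite sq1_sqr; apply/quasi_sub14lq; apply: quasi_le QG; lia.
have red2 c G : quasi c G -> quasi c.+2 (sq2 ^+ 2 * G).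
  by move=> QG; rewrite sq2_sqr; apply/quasi_sub14lp; apply: quasi_le QG; lia.
have [Q1 Q2] := quasi_sq_wneg_wpos k l; have Q0 := quasi_wneg_wpos k l.
case: a => [|[|[|a]]] //; case: b => [|[|[|b]]] // _ _; rewrite ?expr1 ?expr0 ?mul1r ?mulr1 //.
- by rewrite add0n add2n; apply: red2.
- have -> : sq1 * sq2 * (wneg ^+ k * wpos ^+ l) =
    wneg ^+ k.+1 * wpos ^+ l + wneg ^+ k * wpos ^+ l.+1 +
    liota (om 0) * (wneg ^+ k * wpos ^+ l).
    by rewrite -/lw lw_split !exprS; ring.
  apply: quasi_add; first apply: quasi_add.
  + by apply: quasi_le (quasi_wneg_wpos _ _); lia.
  + by apply: quasi_le (quasi_wneg_wpos _ _); lia.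
  + by apply: (quasi_scalM _ (scal_om 0)); rewrite ?add2n ?subn2.
- by rewrite mulrAC mulrC; apply: red2.
- by rewrite addn0 add2n; apply: red1.
- by rewrite -mulrA; apply: red1.
- by rewrite -mulrA; apply: red1; apply: red2.
Qed.

(** Induction on both derivations; only products of two generators have content, and these are
    monomials in s1, s2, w-, w+. *)
Lemma quasiM d e F G : quasi d F -> quasi e G -> quasi (d + e) (F * G).
Proof.
have base a b k l a' b' k' l' : (a + a' <= 2)%N -> (b + b' <= 2)%N ->
    quasi (a + b + (k + l).*2 + (a' + b' + (k' + l').*2))
      ((sq1 ^+ a * sq2 ^+ b * (wneg ^+ k * wpos ^+ l)) *
       (sq1 ^+ a' * sq2 ^+ b' * (wneg ^+ k' * wpos ^+ l'))).
  move=> a2 b2.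
  have := quasi_monomial (k + k') (l + l') a2 b2.
  rewrite !exprD.
  have -> : (a + a' + (b + b') + (k + k' + (l + l')).*2 =
    a + b + (k + l).*2 + (a' + b' + (k' + l').*2))%N by lia.
  by congr quasi; ring.
have bposE (b : bool) k : bpos b k = sq1 ^+ 0 * sq2 ^+ b * (wneg ^+ 0 * wpos ^+ k).
  by rewrite /bpos !expr0 !mul1r.
have bnegE (b : bool) k : bneg b k = sq1 ^+ b * sq2 ^+ 0 * (wneg ^+ k * wpos ^+ 0).
  by rewrite /bneg !expr0 !mulr1.
move=> QF; elim: QF e G => {d F}.
- move=> b k e G; elim=> {e G}.
  + move=> b' k'; rewrite !bposE.
    by have := base 0 b 0 k 0 b' 0 k'; rewrite !add0n; apply=> //; case: b b' => [] [].
  + move=> b' k'; rewrite bposE bnegE.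
    have := base 0 b 0 k b' 0 k' 0; rewrite !add0n !addn0; apply=> //; first by case: b'.
    by case: b.
  + by move=> e F G _ IHF _ IHG; rewrite mulrDr; apply: quasi_add.
  + by move=> e G _ IHG; rewrite mulrCA; apply: quasi_lp.
  + by move=> e G _ IHG; rewrite mulrCA; apply: quasi_lq.
  + move=> e e' a G Aa _ IHG; rewrite mulrCA addnCA; exact: quasi_scal.
  + by move=> e e' G ee' _ IHG; apply: quasi_le IHG; rewrite leq_add2l.
- move=> b k e G; elim=> {e G}.
  + move=> b' k'; rewrite bposE bnegE.
    have := base b 0 k 0 0 b' 0 k'; rewrite !add0n !addn0; apply=> //; first by case: b.
    by case: b'.
  + move=> b' k'; rewrite !bnegE.
    by have := base b 0 k 0 b' 0 k' 0; rewrite !addn0; apply=> //; case: b b' => [] [].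
  + by move=> e F G _ IHF _ IHG; rewrite mulrDr; apply: quasi_add.
  + by move=> e G _ IHG; rewrite mulrCA; apply: quasi_lp.
  + by move=> e G _ IHG; rewrite mulrCA; apply: quasi_lq.
  + move=> e e' a G Aa _ IHG; rewrite mulrCA addnCA; exact: quasi_scal.
  + by move=> e e' G ee' _ IHG; apply: quasi_le IHG; rewrite leq_add2l.
- by move=> d F F' _ IHF _ IHF' e G QG; rewrite mulrDl; apply: quasi_add; auto.
- by move=> d F _ IHF e G QG; rewrite -mulrA; apply: quasi_lp; auto.
- by move=> d F _ IHF e G QG; rewrite -mulrA; apply: quasi_lq; auto.
- by move=> d d' a F Aa _ IHF e G QG; rewrite -mulrA -addnA; apply: quasi_scal; auto.
- by move=> d d' F dd' _ IHF e G QG; apply: quasi_le (IHF e G QG); rewrite leq_add2r.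
Qed.

Lemma bounded_wpos : bounded wpos.
Proof. exact: flip_bounded (flip_sym flip_wpos). Qed.

Lemma cf_sq2 d : cf sq2 d = if d is Posz n then fpsC (fps_sqrt14t n) * fps_t ^+ n else 0.
Proof.
apply/fpsP => m; rewrite /= icoefZ icoefXn; case: d => n.
  rewrite fps_coef_CM -fps_of_polyXn [_ m in RHS]/= coefXn.
  have -> : (m%:Z + n == (m + m)%N) = (m == n) by lia.
  by case: eqP => [->|_]; rewrite ?mulr0.
by rewrite fps_coef0 (_ : (_ == _) = false) ?mulr0 //; lia.
Qed.

Lemma pos_sq2 : pos sq2.
Proof. by case=> // n _; rewrite cf_sq2. Qed.

Lemma pos_wpos : pos wpos.
Proof. by move=> d d0; rewrite cf_wpos ltNge ltW. Qed.

Lemma pos_liota a : pos (liota a).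
Proof. by move=> d d0; rewrite cf_liota; case: eqP d0 => // ->. Qed.

(** No factor has negative y-degree, so each coefficient is a finite convolution, in which a further
    factor w+ contributes series [om i] of degree 2. *)
Lemma scal_cf_bpos (e : bool) k d : scal (e + k.*2) (cf (bpos e k) d).
Proof.
suff [] : pos (bpos e k) /\ forall d, scal (e + k.*2) (cf (bpos e k) d) by [].
elim: k => [|k [IHp IHs]].
  have -> : bpos e 0 = if e then sq2 else liota 1.
    by rewrite /bpos mulr1 rmorph1; case: e.
  split=> [|{}d]; first by case: (e); [apply: pos_sq2|apply: pos_liota].
  case: (e); last by rewrite cf_liota; case: eqP => _; [apply: scal1|apply: scal0].
  rewrite cf_sq2; case: d => n; last exact: scal0.
  exact/scalCM/scal_tX.
have bposS : bpos e k.+1 = bpos e k * wpos by rewrite /bpos exprSr mulrA.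
split=> [|{}d]; rewrite bposS; first exact: posM pos_wpos bounded_wpos.
case: d => n; last by rewrite (posM IHp pos_wpos bounded_wpos) //; apply: scal0.
rewrite (cfM_pos_nat n IHp pos_wpos bounded_wpos); apply: scal_sum => i.
have -> : (e + k.+1.*2 = (e + k.*2) + 2)%N by lia.
apply: scalM => //; rewrite cf_wpos; case: ifP => _; last exact: scal0.
exact: scal_om.
Qed.

Lemma scal_cf d G k : quasi d G -> scal d (cf G k).
Proof.
move=> QG; elim: QG k => {d G}.
- by move=> e k d; apply: scal_cf_bpos.
- move=> e k d.
  rewrite (flipM (flipX e (flip_sym flip_sq1)) (flipX k flip_wpos) d).
  exact: scal_cf_bpos.
- by move=> d F G _ IHF _ IHG k; rewrite cfD; apply: scalD.
- by move=> d G _ IHG k; rewrite cf_lpM; apply: scaltM.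
- by move=> d G _ IHG k; rewrite cf_lqM; apply: scaltM.
- by move=> d e a G Aa _ IHG k; rewrite cf_liotaM; apply: scalM.
- by move=> d e G de _ IHG k; apply: scal_le (IHG k).
Qed.

Lemma npart_liotaM a G : npart (liota a * G) = liota a * npart G.
Proof.
apply: cfP => d; rewrite cf_liotaM !cf_npart cf_liotaM.
by case: ifP; rewrite ?mulr0.
Qed.

(** Multiplication by p raises the y-degree by one, so the constant term of G leaves the nonpositive
    part; multiplication by q, treated next, lets the coefficient of y enter it. *)
Lemma npart_lpM G : npart (lp * G) = lp * npart G - lp * liota (cf G 0).
Proof.
apply: cfP => d; rewrite cfB !cf_lpM !cf_npart cf_lpM cf_liota -mulrBr subr_eq0.
have -> : (d - 1 <= 0) = (d <= 0) || (d == 1) by lia.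
case: eqP => [->|/eqP d1]; first by rewrite /= subrr mulr0.
by rewrite orbF subr0; case: ifP; rewrite ?mulr0.
Qed.

Lemma npart_lqM G : npart (lq * G) = lq * npart G + liota (fps_t * cf G 1).
Proof.
apply: cfP => d; rewrite cfD !cf_lqM !cf_npart cf_lqM cf_liota.
have -> : (d + 1 <= 0) = (d <= 0) && (d != 0) by lia.
case: eqP => [->|_]; first by rewrite /= mulr0 !add0r.
by rewrite andbT addr0; case: ifP; rewrite ?mulr0.
Qed.

Lemma pos_bpos e k : pos (bpos e k).
Proof.
rewrite /bpos; elim: k => [|k IHk].
  rewrite mulr1; case: e => //; first exact: pos_sq2.
  by rewrite expr0 -(rmorph1 liota); apply: pos_liota.
by rewrite exprSr mulrA; apply: posM pos_wpos bounded_wpos.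
Qed.

(** This is where one-sidedness matters: [bpos e k] keeps only its constant term, a scalar of the
    same degree, and [bneg e k] is unchanged. *)
Lemma quasi_npart d G : quasi d G -> quasi d (npart G).
Proof.
elim=> {d G}.
- move=> e k; have -> : npart (bpos e k) = liota (cf (bpos e k) 0).
    apply: cfP => d; rewrite cf_npart cf_liota.
    by case: ltgtP => // [/pos_bpos ->|->].
  exact/quasi_liota/scal_cf_bpos.
- move=> e k; have -> : npart (bneg e k) = bneg e k; last exact: quasi_bneg.
  apply: cfP => d; rewrite cf_npart leNgt; case: ltP => //= d0.
  have -> := flipM (flipX e (flip_sym flip_sq1)) (flipX k flip_wpos) d.
  by rewrite pos_bpos // oppr_lt0.
- by move=> d F G _ IHF _ IHG; rewrite npartD; apply: quasi_add.
- move=> d G QG IHG; rewrite npart_lpM; apply: quasiB; apply: quasi_lp => //.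
  exact/quasi_liota/scal_cf.
- move=> d G QG IHG; rewrite npart_lqM; apply: quasi_add; first exact: quasi_lq.
  exact/quasi_liota/scaltM/scal_cf.
- by move=> d e a G Aa _ IHG; rewrite npart_liotaM; apply: quasi_scal.
- by move=> d e G de _ IHG; apply: quasi_le IHG.
Qed.

(** Membership up to a power of t is what is shown for Cat (t / y); the power can be divided out at
    the end without changing degrees. *)
Definition tquasi d (G : lser) := exists n, quasi d (liota (fps_t ^+ n) * G).

Lemma tquasiM d e F G : tquasi d F -> tquasi e G -> tquasi (d + e) (F * G).
Proof.
move=> [m QF] [n QG]; exists (m + n)%N.
by rewrite exprD rmorphM mulrACA; apply: quasiM.
Qed.

Lemma tquasi_npart d G : tquasi d G -> tquasi d (npart G).
Proof.
by move=> [n QG]; exists n; rewrite -npart_liotaM; apply: quasi_npart.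
Qed.

Lemma tquasi_fpart d G : tquasi d G -> tquasi d (fpart G).
Proof.
move=> /tquasi_npart [n /quasi_flip [G' fG QG']]; exists n.
have -> // : liota (fps_t ^+ n) * fpart G = G'.
exact: flip_uniq (flip_liotaM _ (flip_fpart G)) fG.
Qed.

Lemma tquasi_cf0 d G : tquasi d G -> expressible false d (laurent_of (cf G 0)).
Proof.
move=> [n QG]; apply: (@expressible_tXM _ _ n); rewrite -cf_liotaM.
exact: scal_cf.
Qed.

(** * Evaluation at y = 1 *)

Definition lev (G : lser) : fps := FPS (fun m => (G m).[1]).

Lemma levM F G : lev (F * G) = lev F * lev G.
Proof.
apply/fpsP => m; rewrite fps_coefM /= horner_sum.
by apply: eq_bigr => i _; rewrite hornerM.
Qed.
Lemma levD F G : lev (F + G) = lev F + lev G.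
Proof. by apply/fpsP => m; rewrite fps_coefD /= hornerD. Qed.
Lemma lev_liota a : lev (liota a) = a.
Proof. by apply/fpsP => m; rewrite /= hornerZ hornerXn expr1n mulr1. Qed.
Lemma lev1 : lev 1 = 1.
Proof. by rewrite -(rmorph1 liota) lev_liota. Qed.
Lemma levX F k : lev (F ^+ k) = lev F ^+ k.
Proof. by elim: k => [|k IHk]; rewrite ?lev1 // !exprS levM IHk. Qed.
Lemma lev_lp : lev lp = fps_t.
Proof.
apply/fpsP => -[|[|m]]; rewrite /= ?horner0 ?coefX //.
by rewrite hornerXn expr1n.
Qed.
Lemma lev_lq : lev lq = fps_t.
Proof. by apply/fpsP => -[|[|m]]; rewrite /= ?horner0 ?hornerC ?coefX. Qed.
Lemma lev_sq1 : lev sq1 = fps_sqrt14t.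
Proof. by apply/fpsP => m; rewrite /= hornerC. Qed.
Lemma lev_flip F F' : flip F F' -> lev F = lev F'.
Proof.
move=> f; apply/fpsP => m; have [E E'] := revpP (flip_revp m f).
rewrite /= [in LHS]E [in RHS]E' !horner_sum; apply: eq_bigr => i _.
by rewrite !hornerZ !hornerXn !expr1n.
Qed.

(** At y = 1 both roots become sqrt (1 - 4 t), so w becomes 1 - 4 t, while w- and w+ take equal
    values by symmetry. *)
Lemma lev_wneg : fpsC 2 * lev wneg = 1 - fpsC 4 * fps_t - om 0.
Proof.
have := congr1 lev lw_split; rewrite 2!levD lev_liota (lev_flip flip_wpos).
rewrite {1}/lw levM -(lev_flip flip_sq1) lev_sq1 -expr2 fps_sqrt14t_sqr.
have -> : fps_of_poly (1 - 4 *: 'X) = 1 - fpsC 4 * fps_t.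
  apply/fpsP => m; rewrite fps_coefD fps_coefN fps_coef_CM fps_coef1.
  by rewrite fps_polyE coefB coefZ coef1.
by move=> ->; rewrite rmorph_nat; ring.
Qed.

Lemma expressible_lev_wneg : expressible true 2 (laurent_of (lev wneg)).
Proof.
apply: expressible_sqrt; rewrite -/(scal 2 _).
have -> : lev wneg = fpsC 2^-1 * (fpsC 2 * lev wneg).
  by rewrite mulrA -rmorphM mulVf // rmorph1 mul1r.
rewrite lev_wneg; apply/scalCM/scalB; last exact: scal_om.
by apply: scalB; [apply: scal1|apply/scalCM/scal_t].
Qed.

Lemma expressible_lev_base (e : bool) k :
  expressible true (e + k.*2) (laurent_of (fps_sqrt14t ^+ e * lev wneg ^+ k)).
Proof.
rewrite tofracM; apply: expr_mul.
  case: e; rewrite ?expr1 ?expr0; first exact: expr_sqrt.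
  by apply: expressible_sqrt; apply: scal1.
elim: k => [|k IHk].
  by rewrite expr0; apply: expressible_sqrt; apply: scal1.
by rewrite exprS tofracM doubleS -add2n; apply: expr_mul IHk; apply: expressible_lev_wneg.
Qed.

Lemma expressible_lev d G : quasi d G -> expressible true d (laurent_of (lev G)).
Proof.
have scalE e a : scal e a -> expressible true e (laurent_of a).
  exact: expressible_sqrt.
elim=> {d G}.
- move=> e k; rewrite /bpos levM !levX (lev_flip flip_wpos) -(lev_flip flip_sq1).
  by rewrite lev_sq1; apply: expressible_lev_base.
- by move=> e k; rewrite /bneg levM !levX lev_sq1; apply: expressible_lev_base.
- by move=> d F G _ IHF _ IHG; rewrite levD tofracD; apply: expr_add.
- move=> d G _ IHG; rewrite levM tofracM lev_lp -[d]add0n; apply: expr_mul IHG.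
  exact/scalE/scal_t.
- move=> d G _ IHG; rewrite levM tofracM lev_lq -[d]add0n; apply: expr_mul IHG.
  exact/scalE/scal_t.
- move=> d e a G Aa _ IHG; rewrite levM tofracM lev_liota; apply: expr_mul IHG.
  exact: scalE.
- by move=> d e G de _; apply: expr_le.
Qed.

Lemma tquasi_lev d G : tquasi d G ->
  expressible true d (laurent_of (lev (npart G))).
Proof.
move=> /tquasi_npart [n QG]; apply: (@expressible_tXM _ _ n).
by rewrite -[fps_t ^+ n in X in laurent_of X]lev_liota -levM; apply: expressible_lev.
Qed.

Lemma liota_CM c G m : (liota (fpsC c) * G) m = c *: G m.
Proof.
rewrite pser_coefM big_ord_recl subn0 big1 ?addr0 /= ?coefC => [|i _].
  by rewrite expr0 -scalerAl mul1r.
by rewrite coefC scale0r mul0r.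
Qed.

Definition lcat : lser := PSer (fun m => (Cat m)%:P).

(** Coefficientwise form of 1 - sqrt (1 - 4 x) = 2 x Cat (x); both sides obey the same first-order
    recurrence. *)
Lemma Cat_sqrt n : - fps_sqrt14t n.+1 = 2 * Cat n.
Proof.
elim: n => [|n IHn].
  by rewrite /fps_sqrt14t /= /rising big_ord1 /Cat bin0 (_ : 1`! = 1)%N //=.
apply: (@mulfI _ n.+2%:R); first by rewrite pnatr_eq0.
rewrite mulrN fps_sqrt14t_rec -mulrN IHn /Cat.
(* The recurrence of the central binomial coefficients, kept free of division so that it holds in
   the naturals. *)
have binE : (n.+1 * n.+1 * 'C(n.+1.*2, n.+1) = n.+1 * 2 * (n.*2.+1 * 'C(n.*2, n)))%N.
  rewrite doubleS.
  have e1 := mul_bin_diag n.*2.+1 n.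
  have e2 := mul_bin_left n.*2.+1 n.
  rewrite (_ : n.*2.+1 - n = n.+1)%N in e2; last by lia.
  by rewrite binS -mulnA mulnDr -e2 -e1 /= addnn -mul2n mulnA.
move/(congr1 (fun x : nat => x%:R : rat)) : binE.
have n0 k : k.+1%:R != 0 :> rat by rewrite pnatr_eq0.
rewrite !natrM => binE.
have -> : 'C(n.+1.*2, n.+1)%:R = 2 * (n.*2.+1)%:R * 'C(n.*2, n)%:R / n.+1%:R :> rat.
  apply: (@mulfI _ (n.+1%:R * n.+1%:R)); first by rewrite mulf_neq0.
  by rewrite binE; have := n0 n; move: (n.+1%:R : rat) => x x0; field.
rewrite -[n.*2.+1]addn1 -mul2n natrD natrM -!natr1.
have := n0 n; have := n0 n.+1; rewrite -!natr1.
by move: (n%:R) ('C(_, _)%:R) => x b x0 x1; field; rewrite x0 x1.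
Qed.

(** As t^2 = p q, one has t^2 Cat (q) = p (1 - s1) / 2, and s1 has degree 1. *)
Lemma tquasi_lcat : tquasi 1 lcat.
Proof.
exists 2%N; have -> : liota (fps_t ^+ 2) * lcat =
    lp * (liota (fpsC 2^-1) * (1 - sq1)).
  rewrite -lpq -!mulrA; congr (_ * _); apply/pserP => m.
  rewrite pser_linM liota_CM pser_coefD pser_coefN pser_coef1.
  case: m => [|m]; last first.
    by rewrite sub0r mul1r -polyCN Cat_sqrt -mul_polyC -polyCM mulKf.
  by rewrite /= /fps_sqrt14t /= /rising big_ord0 fact0 expr0 divr1 mulr1 subrr scaler0.
apply/quasi_lp/quasi_CM/quasiB; first exact: quasi1.
by have := quasi_bneg true 0; rewrite /bneg mulr1 expr1.
Qed.

(** * Leaf removal *)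

Section TreeSum.
Variables (V : finType) (E : {set {set V}}).

Definition labels (N : nat) := {ffun edge E -> 'I_N.+1}.

(** Families on the edges inside U are encoded as families on all edges vanishing elsewhere, so that
    the index type stays fixed while U grows. *)
Definition supported N (U : {set V}) (x : labels N) :=
  [forall e : edge E, (val e \subset U) || (x e == ord0)].

Definition vsum N (x : labels N) (v : V) : nat := vertex_sum (val \o x) v.

(* The labels are bounded by N, so only the coefficients of index at most N
   are meaningful. *)
Definition tsum N (U : {set V}) (G : V -> lser) : fps :=
  \sum_(x : labels N | supported U x) \prod_(v in U) cf (G v) (- (vsum x v)%:Z).

Definition upd N (x : labels N) (e0 : edge E) (k : 'I_N.+1) : labels N :=
  [ffun e => if e == e0 then k else x e].

Lemma fps_eqM N (a b c : fps) :
  (forall m, (m <= N)%N -> a m = b m) ->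
  forall m, (m <= N)%N -> (a * c) m = (b * c) m.
Proof.
move=> ab m mN; rewrite !fps_coefM; apply: eq_bigr => i _.
by rewrite ab // (leq_trans _ mN) // -ltnS.
Qed.

Lemma vsum_upd N (x : labels N) e0 k v : x e0 = ord0 ->
  vsum (upd x e0 k) v = (vsum x v + (v \in val e0) * k)%N.
Proof.
move=> x0; rewrite /vsum /vertex_sum.
have [ve|nve] := boolP (v \in val e0); last first.
  rewrite mul0n addn0; apply: eq_bigr => e ve /=; rewrite ffunE.
  by case: eqP ve nve => // -> ->.
rewrite mul1n (bigD1 e0) //= ffunE eqxx [in RHS](bigD1 e0) //= x0 add0n addnC.
by congr addn; apply: eq_bigr => e /andP [_ ee0]; rewrite ffunE (negbTE ee0).
Qed.

(** Here v is a leaf attached to u. With X the sum at u of the other labels, summing [y^(-X - k)]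
    G_u times [y^(-k)] G_v over the label k of the edge gives the coefficient of y^(-X) in
    [G u * fpart (G v)]. The bound k <= N is harmless in rows m <= N. *)
Lemma tsum_leaf N (U : {set V}) (G G' : V -> lser) (u v : V) m :
  (forall e, e \in E -> (#|e| == 1%N) || (#|e| == 2%N)) ->
  u \in U -> v \notin U -> [set u; v] \in E -> [set v] \notin E ->
  (forall w, w \in U -> [set w; v] \in E -> w = u) ->
  G' u = G u * fpart (G v) -> (forall w, w != u -> G' w = G w) ->
  (m <= N)%N ->
  tsum N (v |: U) G m = tsum N U G' m.
Proof.
move=> cardE uU vU uvE vE uniq_u G'u G'w mN.
pose e0 : edge E := exist _ [set u; v] uvE.
have e0E : val e0 = [set u; v] by [].
have ve0 : v \in val e0 by rewrite e0E !inE eqxx orbT.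
have ue0 : u \in val e0 by rewrite e0E !inE eqxx.
have e0U : ~~ (val e0 \subset U) by apply: contra vU => /fintype.subsetP; apply.
have e0vU : val e0 \subset v |: U.
  by rewrite e0E; apply/fintype.subsetP => w; rewrite !inE => /orP [] /eqP ->; rewrite ?uU ?eqxx ?orbT.
(* An edge other than [e0] inside [v |: U] avoids v: there is no half-edge at v, and an ordinary
   edge at v would have u as its other end. *)
have edgeU (e : edge E) : val e \subset v |: U -> e != e0 -> val e \subset U.
  move=> /fintype.subsetP esub ne; apply/fintype.subsetP => w we.
  have := esub w we; rewrite !inE => /orP [/eqP wv|//]; move: we; rewrite wv {w wv} => we.
  case/negP: ne; rewrite -val_eqE e0E /=.
  have /orP [/cards1P [z ez]|/cards2P [y [z [yz ez]]]] := cardE _ (valP e).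
    by move: we vE (valP e); rewrite ez inE => /eqP -> /negP.
  move: we; rewrite ez !inE => /orP [] /eqP vz; subst v.
    rewrite finset.setUC; have zU : z \in U.
      by have := esub z; rewrite ez !inE eqxx orbT eq_sym (negbTE yz) /=; apply.
    have zu : z = u by apply: uniq_u => //; rewrite finset.setUC -ez; apply: valP.
    by rewrite -zu -ez.
  have yU : y \in U.
    by have := esub y; rewrite ez !inE eqxx (negbTE yz) /=; apply.
  have yu : y = u by apply: uniq_u => //; rewrite -ez; apply: valP.
  by rewrite -yu -ez.
have supp0 (x : labels N) : supported U x -> x e0 = ord0.
  by move/forallP/(_ e0); rewrite (negbTE e0U) => /eqP.
have vsum_v (x : labels N) : supported U x -> vsum x v = 0%N.
  move=> /forallP sx; rewrite /vsum /vertex_sum big1 // => e ve /=.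
  have := sx e; case: fintype.subsetP => [/(_ v ve)|_ /eqP -> //].
  by rewrite (negbTE vU).
rewrite /tsum.
(* A family on the larger set is a family y on U together with the label k of [e0]. *)
have -> : \sum_(x : labels N | supported (v |: U) x)
     \prod_(w in v |: U) cf (G w) (- (vsum x w)%:Z) =
   \sum_(y : labels N | supported U y) \sum_(k < N.+1)
     \prod_(w in v |: U) cf (G w) (- (vsum (upd y e0 k) w)%:Z).
  rewrite pair_big /=.
  rewrite (reindex_onto (fun yk : labels N * 'I_N.+1 => upd yk.1 e0 yk.2)
             (fun x => (upd x e0 ord0, x e0))) /=; last first.
    by move=> x _; apply/ffunP => e; rewrite !ffunE; case: eqP => [->|].
  apply: eq_bigl => -[y k] /=; rewrite andbT.
  have -> : upd y e0 k e0 = k by rewrite ffunE eqxx.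
  have -> : upd (upd y e0 k) e0 ord0 = upd y e0 ord0.
    by apply/ffunP => e; rewrite !ffunE; case: eqP.
  rewrite xpair_eqE eqxx andbT; apply/andP/idP.
    move=> [/forallP sy /eqP yE]; apply/forallP => e.
    have [->|ne] := eqVneq e e0; first by rewrite -yE ffunE eqxx orbT.
    have := sy e; rewrite ffunE (negbTE ne) => /orP [/edgeU -> //|->].
    by rewrite orbT.
  move=> sy; split.
    apply/forallP => e; rewrite ffunE.
    have [->|_] := eqVneq e e0; first by rewrite e0vU.
    have /forallP /(_ e) /orP [eU|->] := sy; last by rewrite orbT.
    by rewrite (fintype.subset_trans eU) ?finset.subsetUr.
  by apply/eqP/ffunP => e; rewrite ffunE; case: eqP => // ->; rewrite supp0.
rewrite !fps_coef_sum; apply: eq_bigr => y sy.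
transitivity (((\sum_(k < N.+1) cf (G u) (- (vsum y u)%:Z - k%:Z) *
    cf (fpart (G v)) k%:Z) *
  \prod_(w in U | w != u) cf (G w) (- (vsum y w)%:Z)) m).
  congr (fps_coef _ m); rewrite mulr_suml; apply: eq_bigr => k _.
  rewrite big_setU1 //= (bigD1 u) //= !vsum_upd ?supp0 // ve0 ue0 !mul1n vsum_v //.
  rewrite add0n cf_fpart /= mulrA [X in X * _ = _]mulrC.
  congr (cf _ _ * _ * _); first by rewrite PoszD opprD.
  apply: eq_bigr => w /andP [wU wu]; rewrite vsum_upd ?supp0 //.
  rewrite e0E !inE (negbTE wu) /=; case: eqP wU vU => [-> -> //|].
  by rewrite mul0n addn0.
have prodE : \prod_(w in U | w != u) cf (G' w) (- (vsum y w)%:Z) =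
    \prod_(w in U | w != u) cf (G w) (- (vsum y w)%:Z).
  by apply: eq_bigr => w /andP [_ wu]; rewrite G'w.
rewrite [in RHS](bigD1 u) // G'u prodE.
(* The sum over k agrees with the full convolution only in rows at most N, which is enough for this
   coefficient of the product. *)
apply: (@fps_eqM N) => // {mN}m mN; rewrite -cfM_pos //.
- by move=> d d0; rewrite cf_fpart leNgt d0.
- exact: flip_bounded (flip_fpart _).
Qed.

(** Only a half-edge can lie inside {r}. Its label k selects the coefficient of y^(-k) in F, and
    summing over k evaluates the nonpositive part at y = 1. Without it, the zero family alone
    remains. *)
Lemma tsum_root N (r : V) F m :
  (forall e, e \in E -> (#|e| == 1%N) || (#|e| == 2%N)) -> (m <= N)%N ->
  tsum N [set r] (fun=> F) m =
  if [set r] \in E then lev (npart F) m else cf F 0 m.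
Proof.
move=> cardE mN; rewrite /tsum.
have sub_r (e : edge E) : val e \subset [set r] -> val e = [set r].
  move=> er; apply/eqP; rewrite eqEcard er finset.cards1.
  by case/orP: (cardE _ (valP e)) => /eqP ->.
case: ifPn => [rE|nrE]; last first.
  rewrite (big_pred1 [ffun=> ord0]) => [|x /=].
    rewrite big_set1 (_ : vsum _ _ = 0%N) // /vsum /vertex_sum big1 // => e _ /=.
    by rewrite ffunE.
  apply/forallP/eqP => [sx|-> e]; last by rewrite ffunE eqxx orbT.
  apply/ffunP => e; rewrite ffunE; have := sx e.
  have [/sub_r er _|_ /eqP //] := boolP (val e \subset [set r]).
  by move: nrE; rewrite -er (valP e).
pose e0 : edge E := exist _ [set r] rE; have e0E : val e0 = [set r] by [].
pose x0 : labels N := [ffun=> ord0].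
rewrite (reindex_onto (fun k => upd x0 e0 k) (fun x => x e0)) /=; last first.
  move=> x /forallP sx; apply/ffunP => e; rewrite !ffunE; case: eqP => [->//|ne].
  have := sx e; have [/sub_r er _|_ /eqP //] := boolP (val e \subset [set r]).
  by case: ne; apply: val_inj; rewrite er e0E.
rewrite (eq_bigl xpredT) => [|k]; last first.
  rewrite ffunE eqxx eqxx andbT; apply/forallP => e; rewrite ffunE.
  by have [->|_] := eqVneq e e0; rewrite ?e0E ?subxx // ffunE eqxx orbT.
rewrite fps_coef_sum.
under eq_bigr => k _.
  rewrite big_set1 vsum_upd ?ffunE // e0E inE eqxx mul1n.
  rewrite (_ : vsum x0 r = 0%N) ?add0n; last first.
    by rewrite /vsum /vertex_sum big1 // => e _; rewrite /= ffunE.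
  over.
rewrite /lev /npart [RHS]/= (@horner_coef_wide _ m.+1) ?size_take_poly //.
rewrite (big_ord_widen N.+1 (fun i => (take_poly m.+1 (F m))`_i * 1 ^+ i)) //.
rewrite [RHS](eq_bigr (fun i : 'I_N.+1 => (F m)`_i)) => [|i im]; last first.
  by rewrite coef_take_poly im expr1n mulr1.
(* Labels k > m contribute nothing; the others give the coefficients of index m - k in row m, read
   in reverse order. *)
rewrite (bigID (fun k : 'I_N.+1 => (k < m.+1)%N)) /= [X in _ + X]big1 ?addr0; last first.
  by move=> k km; case D: (m%:Z - k%:Z) => [j|j] //=; lia.
rewrite -!(big_ord_widen N.+1 (fun i => (F m)`_i)) //.
rewrite -(big_ord_widen N.+1 (fun i : nat => icoef (F m) (m%:Z - i%:Z))) //.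
rewrite (reindex_inj rev_ord_inj) /=; apply: eq_bigr => i _.
have il := ltn_ord i.
by rewrite subSS -subzn // opprB addrCA subrr addr0.
Qed.

End TreeSum.

(** * Growing the tree from its root *)

Section TreeGrowth.
Variables (V : finType) (E : {set {set V}}).
Hypothesis treeE : is_tree E.

Definition adj_in (U : {set V}) : rel V :=
  fun x y => [&& graph_adj E x y, x \in U & y \in U].

Lemma graph_adj_sym : ssrbool.symmetric (graph_adj E).
Proof. by move=> x y; rewrite /graph_adj eq_sym finset.setUC. Qed.

Lemma adj_in_connect_sym U : connect_sym (adj_in U).
Proof.
by apply: sym_connect_sym => x y; rewrite /adj_in graph_adj_sym [(x \in U) && _]andbC.
Qed.

(** The root is placed at the end of the half-edge, if any, so that no removed leaf carries it. *)
Lemma root_exists : exists r, forall v, [set v] \in E -> v = r.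
Proof.
case: treeE => /card_gt0P [r0 _] _ half1 _ _.
have [[r rE]|nr] := pselect (exists r, [set r] \in E); last first.
  by exists r0 => v vE; case: nr; exists v.
exists r => v vE; apply: finset.set1_inj.
by apply: (card_le1_eqP half1); rewrite inE ?rE ?vE finset.cards1.
Qed.

(** Two distinct neighbours of v in the connected set U would be joined by a simple path inside U,
    closing a cycle through v of length at least 3. *)
Lemma unique_attachment (U : {set V}) r u u' v :
  (forall w, w \in U -> connect (adj_in U) r w) ->
  u \in U -> u' \in U -> v \notin U ->
  [set u; v] \in E -> [set u'; v] \in E -> u = u'.
Proof.
case: treeE => _ _ _ _ acyclic connU uU u'U vU uvE u'vE.
apply/eqP/negPn/negP => uu'.
have /connectP [p0 path_p0 last_p0] : connect (adj_in U) u u'.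
  by apply: connect_trans (connU _ u'U); rewrite adj_in_connect_sym; apply: connU.
move: last_p0; case: (shortenP path_p0) => p path_p uniq_p _ last_p {p0 path_p0}.
have pU w : w \in p -> w \in U.
  move=> wp; elim: p u path_p {uu' uU uvE uniq_p last_p} wp => //= y p IHp u.
  rewrite inE => /andP [/and3P [_ _ yU] path_p] /orP [/eqP -> //|].
  exact: IHp path_p.
have adjv w : w \in U -> [set w; v] \in E -> graph_adj E w v.
  by move=> wU wvE; rewrite /graph_adj wvE andbT; apply: contraNneq vU => <-.
have /acyclic : ucycle (graph_adj E) (v :: u :: p).
  rewrite /ucycle; apply/andP; split; last first.
    rewrite cons_uniq uniq_p andbT inE negb_or.
    apply/andP; split; first by apply: contraNneq vU => ->.
    by apply: contra vU => /pU.
  rewrite /= rcons_path /= graph_adj_sym adjv //= -last_p adjv // andbT.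
  by apply: sub_path path_p => x y /and3P [].
case: p last_p {path_p uniq_p pU} => // last_p.
by rewrite last_p eqxx in uu'.
Qed.

Lemma boundary_edge (U : {set V}) r : r \in U -> U != [set: V] ->
  exists u v, [/\ u \in U, v \notin U & [set u; v] \in E].
Proof.
case: treeE => _ _ _ conn _ rU UT.
have [w wU] : exists w, w \notin U.
  apply: contrapT => nw; case/eqP: UT; apply/finset.setP => w; rewrite inE.
  by apply/negPn/negP => wU; apply: nw; exists w.
apply: contrapT => nuv; case/negP: wU.
rewrite -(closed_connect _ (conn r w)) // => x y /andP [_ xyE].
apply/idP/idP => [xU|yU]; apply/negPn/negP => nU; apply: nuv.
  by exists x, y.
by exists y, x; rewrite finset.setUC.
Qed.

(** Quantifying over all series G and degrees d makes room for leaf removal, which changes both at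
    the neighbour of the leaf. *)
Definition reducible r (U : {set V}) := forall (G : V -> lser) (d : V -> nat),
  (forall v, tquasi (d v) (G v)) ->
  exists2 F, tquasi (\sum_(v in U) d v)%N F &
    forall N m, (m <= N)%N -> tsum E N U G m = tsum E N [set r] (fun=> F) m.

(** Starting from {r}, vertices are added across boundary edges. Each new vertex v is a leaf of the
    enlarged subtree and can be folded into its neighbour u, whose degree becomes d u + d v; the sum
    of the degrees is preserved. *)
Lemma reducible_setT r :
  (forall v, [set v] \in E -> v = r) -> reducible r [set: V].
Proof.
move=> half_r.
suff grow k : (k < #|V|)%N -> exists U : {set V}, [/\ r \in U, #|U| = k.+1,
    forall w, w \in U -> connect (adj_in U) r w & reducible r U].
  have V0 : (0 < #|V|)%N by case: treeE.
  have [|U [_ cardU _ redU]] := grow #|V|.-1; first by rewrite ltn_predL.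
  have <- // : U = [set: V].
  by apply/eqP; rewrite eqEcard finset.subsetT finset.cardsT cardU (prednK V0) leqnn.
elim: k => [|k IHk] kV.
  exists [set r]; split; rewrite ?finset.set11 ?finset.cards1 //.
    by move=> w /finset.set1P ->; apply: connect0.
  move=> G d QG; exists (G r); first by rewrite big_set1.
  move=> N m _; congr (fps_coef _ m); apply: eq_bigr => x _.
  by rewrite !big_set1.
have [U [rU cardU connU redU]] := IHk (ltnW kV).
have UT : U != [set: V].
  by apply: contraTneq kV => UT; rewrite -finset.cardsT -UT cardU ltnn.
have [u [v [uU vU uvE]]] := boundary_edge rU UT.
exists (v |: U); split.
- by rewrite !inE rU orbT.
- by rewrite cardsU1 vU cardU.
- have subU w : w \in U -> connect (adj_in (v |: U)) r w.
    move=> /connU; apply: connect_sub => x y /and3P [xy xU yU].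
    by apply: connect1; rewrite /adj_in xy !inE xU yU !orbT.
  move=> w /finset.setU1P [->|/subU //].
  apply: connect_trans (subU u uU) (connect1 _).
  rewrite /adj_in /graph_adj uvE !inE uU eqxx !orbT !andbT.
  by apply: contraNneq vU => <-.
move=> G d QG.
have vu : v != u by apply: contraNneq vU => ->.
pose G' w := if w == u then G u * fpart (G v) else G w.
pose d' w := if w == u then (d u + d v)%N else d w.
have [|F QF FE] := redU G' d'.
  move=> w; rewrite /G' /d'; case: eqP => // _.
  by apply: tquasiM => //; apply: tquasi_fpart.
exists F.
  have <- // : (\sum_(w in U) d' w = \sum_(w in v |: U) d w)%N.
  rewrite big_setU1 //= (bigD1 u) //= [in RHS](bigD1 u) //= /d' eqxx.
  rewrite addnA [(d v + _)%N]addnC; congr addn.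
  by apply: eq_bigr => w /andP [_ /negbTE ->].
move=> N m mN; rewrite -FE //; apply: (tsum_leaf _ uU vU uvE _ _ _ _ mN).
- by case: treeE.
- by apply: contra vU => /half_r ->.
- by move=> w wU wvE; apply: unique_attachment connU wU uU vU wvE uvE.
- by rewrite /G' eqxx.
- by move=> w /negbTE wu; rewrite /G' wu.
Qed.

Lemma cf_lcat n : cf lcat (- n%:Z) = fpsC (Cat n) * fps_t ^+ n.
Proof.
apply/fpsP => m; rewrite cfE fps_coef_CM -fps_of_polyXn fps_polyE coefXn.
have -> : lcat m = Cat m *: 'X^0 by rewrite expr0 alg_polyC.
rewrite icoefZ icoefXn (_ : (_ == _) = (m == n)); last by lia.
by case: eqP => [->|_]; rewrite ?mulr0.
Qed.

(** With N = m the families are those of [treeS], and the product of the powers t^X over the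
    vertices selects the families of total sum m. *)
Lemma treeS_tsum m : treeS E m = tsum E m [set: V] (fun=> lcat) m.
Proof.
rewrite /tsum fps_coef_sum /= big_mkcond /=.
rewrite [RHS](eq_bigl xpredT); last first.
  by move=> x; apply/forallP => e; rewrite finset.subsetT.
apply: eq_bigr => x _.
rewrite [in RHS](eq_bigl xpredT) => [|v]; last by rewrite inE.
under [X in _ = fps_coef X m]eq_bigr => v _ do rewrite cf_lcat.
have -> : \prod_v (fpsC (Cat (vsum x v)) * fps_t ^+ vsum x v) =
    fpsC (\prod_v Cat (vsum x v)) * fps_t ^+ total_sum (val \o x).
  by rewrite rmorph_prod -prodrXr -big_split.
rewrite fps_coef_CM -fps_of_polyXn fps_polyE coefXn [_ == m]eq_sym.
by case: eqP; rewrite ?mulr1 ?mulr0.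
Qed.

(** Every vertex starts with Cat (t / y), of degree 1, whence the degree #|V|. *)
Lemma treeS_reduction : exists F r, [/\ tquasi #|V| F,
  forall v, [set v] \in E -> v = r &
  treeS E = if [set r] \in E then lev (npart F) else cf F 0].
Proof.
have [r half_r] := root_exists.
have [F QF FE] := reducible_setT half_r (fun _ => tquasi_lcat).
exists F, r; split=> //.
  by move: QF; rewrite sum1_card finset.cardsT.
apply/fpsP => m; rewrite treeS_tsum FE // tsum_root //; last by case: treeE.
by case: ifP.
Qed.

Lemma expressible_treeS (b : bool) : (#|half_edges E| <= b)%N ->
  expressible b #|V| (laurent_of (treeS E)).
Proof.
have [F [r [QF half_r ->]]] := treeS_reduction.
case: ifPn => [rE|_ _]; last exact/expressible_sqrt/tquasi_cf0.
case: b => [_|]; first exact: tquasi_lev.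
by rewrite leqn0 cards_eq0 => /eqP /finset.setP /(_ [set r]); rewrite !inE rE finset.cards1.
Qed.

End TreeGrowth.

(** * From expressions to polynomials *)

Section WeightedExpressions.
Variables (n : nat) (g : n.-tuple laurent) (w : n.-tuple nat).

Definition mweight_le (P : mpoly n laurent) d := forall m, m \in msupp P ->
  (\sum_(i < n) tnth w i * m i <= d)%N.

(** Generators and weights are parameters, so that both [algA] and [algB] are covered. *)
Definition wexpr d b :=
  exists2 P, polynomial_expression g P b & mweight_le P d.

Lemma wexpr_laurent d b : laurent_polynomial b -> wexpr d b.
Proof.
move=> lb; exists (mpolyC n b); first split; rewrite ?mevalC //.
  move=> m; rewrite mcoeffC; apply: laurent_polynomialM => //.
  exact: laurent_polynomial_nat.
move=> m; rewrite msuppC; case: ifP => // _; rewrite mem_seq1 => /eqP ->.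
by rewrite big1 // => i _; rewrite mnm0E muln0.
Qed.

Lemma wexpr_gen i : wexpr (tnth w i) (tnth g i).
Proof.
exists (mpolyX laurent (mnm1 i)); first split; rewrite ?mevalXU //.
  by move=> m; rewrite mcoeffX; apply: laurent_polynomial_nat.
move=> m; rewrite msuppX mem_seq1 => /eqP ->.
rewrite (bigD1 i) //= big1 ?addn0 => [|j ji]; rewrite mnm1E ?eqxx ?muln1 //.
by rewrite eq_sym (negbTE ji) muln0.
Qed.

Lemma wexpr_add d b c : wexpr d b -> wexpr d c -> wexpr d (b + c).
Proof.
move=> [P [lP <-] wP] [Q [lQ <-] wQ]; exists (P + Q); first split.
- by move=> m; rewrite mcoeffD; apply: laurent_polynomialD.
- exact: mevalD.
- by move=> m /msuppD_le; rewrite mem_cat => /orP [/wP|/wQ].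
Qed.

Lemma wexpr_mul d e b c : wexpr d b -> wexpr e c -> wexpr (d + e) (b * c).
Proof.
move=> [P [lP <-] wP] [Q [lQ <-] wQ]; exists (P * Q); first split.
- move=> m; rewrite mcoeffM; elim/big_ind: _ => [||k _].
  + exact: (laurent_polynomial_nat 0).
  + exact: laurent_polynomialD.
  + exact: laurent_polynomialM.
- exact: mevalM.
- move=> m /msuppM_le /allpairsP [[m1 m2] /= [/wP w1 /wQ w2 ->]].
  apply: leq_trans (leq_add w1 w2); rewrite -big_split leq_eqVlt.
  by apply/orP/or_introl/eqP/eq_bigr => i _; rewrite mnmDE mulnDr.
Qed.

Lemma wexpr_le d e b : (d <= e)%N -> wexpr d b -> wexpr e b.
Proof.
by move=> de [P eP wP]; exists P => // m /wP wm; apply: leq_trans wm de.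
Qed.

End WeightedExpressions.

Lemma expressible_algA d b : expressible false d b -> b \in algA.
Proof.
move=> eb; rewrite inE; suff [P eP _] : wexpr gensA [tuple 2; 2]%N d b by exists P.
elim: eb => {d b} [d b lb|||//|d b c _ IHb _ IHc|d e b c _ IHb _ IHc|d e b de _].
- exact: wexpr_laurent.
- exact: (@wexpr_gen _ gensA [tuple 2; 2]%N ord0).
- exact: (@wexpr_gen _ gensA [tuple 2; 2]%N ord_max).
- exact: wexpr_add.
- exact: wexpr_mul.
- exact: wexpr_le.
Qed.

Lemma expressible_wexprB r d b : expressible r d b -> wexpr gensB weightsB d b.
Proof.
elim=> {d b} [d b lb||| _|d b c _ IHb _ IHc|d e b c _ IHb _ IHc|d e b de _].
- exact: wexpr_laurent.
- exact: (@wexpr_gen _ gensB weightsB ord0).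
- exact: (@wexpr_gen _ gensB weightsB (Ordinal (isT : (1 < 3)%N))).
- exact: (@wexpr_gen _ gensB weightsB ord_max).
- exact: wexpr_add.
- exact: wexpr_mul.
- exact: wexpr_le.
Qed.

Lemma expressible_algB r d b : expressible r d b -> b \in algB.
Proof. by rewrite inE => /expressible_wexprB [P eP _]; exists P. Qed.

Lemma expressible_degB r d b : expressible r d b -> (degB b <= d)%N.
Proof.
move=> /expressible_wexprB [P eP wP].
have ePd : expression_degree b (weighted_degree P) by apply/asboolP; exists P.
have Pd : (weighted_degree P <= d)%N by apply/bigmax_leqP_seq => m /wP.
rewrite /degB; case: pselect => // ex.
by case: ex_minnP => k _ kmin; apply: leq_trans (kmin _ ePd) Pd.
Qed.

(** * Wallis's product *)



Local Open Scope classical_set_scope.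

Section Wallis.
Variable R : realType.

(* The primitive of sin^n vanishing at 0. *)
Fixpoint sin_prim (n : nat) (x : R) : R :=
  match n with
  | 0 => x
  | 1 => 1 - cos x
  | m.+2 => m.+2%:R^-1 * (m.+1%:R * sin_prim m x - sin x ^+ m.+1 * cos x)
  end.

(** Integration by parts: sin^(n + 1) cos has derivative (n + 1) sin^n cos^2 - sin^(n + 2), and
    cos^2 = 1 - sin^2. *)
Lemma is_derive_sin_prim n (x : R) : is_derive x 1 (sin_prim n) (sin x ^+ n).
Proof.
suff: is_derive x 1 (sin_prim n) (sin x ^+ n) /\
      is_derive x 1 (sin_prim n.+1) (sin x ^+ n.+1) by case.
elim: n => [|n [IHn IHn1]]; split=> //.
- rewrite expr0; have -> : sin_prim 0 = id by apply/funext.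
  exact: is_derive_id.
- have -> : sin_prim 1 = cst 1 - cos by apply/funext.
  apply: is_derive_eq; rewrite sub0r opprK expr1 //.
have -> : sin_prim n.+2 = n.+2%:R^-1 *: (n.+1%:R *: sin_prim n - (sin ^+ n.+1) * cos).
  by apply/funext => y; rewrite !fctE.
apply: is_derive_eq; rewrite /= !fctE.
apply: (@mulfI _ n.+2%:R); first by rewrite pnatr_eq0.
rewrite [LHS]mulrA mulfV ?pnatr_eq0 // mul1r.
rewrite -![_ *: _]/(_ * _) !exprS -!natr1.
transitivity ((n%:R + 1) * sin x ^+ n + sin x ^+ 2 * sin x ^+ n -
  (n%:R + 1) * sin x ^+ n * cos x ^+ 2); first by ring.
by rewrite cos2sin2; ring.
Qed.

Lemma sin_prim0 n : sin_prim n 0 = 0.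
Proof.
suff: sin_prim n 0 = 0 /\ sin_prim n.+1 0 = 0 by case.
elim: n => [|n [IHn IHn1]]; first by rewrite /= cos0 subrr.
by split=> //=; rewrite IHn sin0 expr0n mulr0 mul0r subrr mulr0.
Qed.

(** The integral of sin^n over [0, pi / 2]. *)
Definition wallis n : R := sin_prim n (pi / 2).

Lemma wallisSS n : wallis n.+2 = n.+1%:R / n.+2%:R * wallis n.
Proof. by rewrite /wallis /= cos_pihalf mulr0 subr0 mulrA [X in X * _]mulrC. Qed.

(** Mean value theorem: the difference of the primitives has derivative sin^n (1 - sin), nonnegative
    on [0, pi / 2]. *)
Lemma wallis_anti n : wallis n.+1 <= wallis n.
Proof.
rewrite -subr_ge0 /wallis.
have D (x : R) : is_derive x 1 (sin_prim n - sin_prim n.+1) (sin x ^+ n - sin x ^+ n.+1).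
  have Dn := is_derive_sin_prim n x; have Dn1 := is_derive_sin_prim n.+1 x.
  exact: is_deriveB.
have pi2 : 0 < pi / 2 :> R by rewrite divr_gt0 ?pi_gt0.
have [|x x01] := MVT pi2 (fun x _ => D x).
  apply: continuous_subspaceT => x; apply: differentiable_continuous.
  by apply/derivable1_diffP; case: (D x).
rewrite !fctE !sin_prim0 !subr0 => ->.
apply: mulr_ge0; last exact: ltW.
have sx0 : 0 <= sin x.
  apply: sin_ge0_pi; move: x01; rewrite in_itv /= => /andP [/ltW -> /ltW xpi] /=.
  by apply: le_trans xpi _; rewrite ler_pdivrMr // ler_peMr ?pi_ge0 // ler1n.
by rewrite exprS -{1}[sin x ^+ n]mul1r -mulrBl mulr_ge0 ?exprn_ge0 // subr_ge0 sin_le1.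
Qed.

(* The n-th central binomial coefficient divided by 4^n. *)
Definition cbin n : R := \prod_(i < n) (i.*2.+1%:R / i.*2.+2%:R).

Lemma cbinS n : cbin n.+1 = n.*2.+1%:R / n.*2.+2%:R * cbin n.
Proof. by rewrite /cbin big_ord_recr /= mulrC. Qed.

Lemma cbin_gt0 n : 0 < cbin n.
Proof. by apply: prodr_gt0 => i _; rewrite divr_gt0 ?ltr0n. Qed.

Lemma wallis_even n : wallis n.*2 = pi / 2 * cbin n.
Proof.
elim: n => [|n IHn]; first by rewrite /cbin big_ord0 mulr1.
by rewrite doubleS wallisSS IHn cbinS mulrCA.
Qed.

Lemma wallis_odd n : wallis n.*2.+1 = (n.*2.+1%:R * cbin n)^-1.
Proof.
elim: n => [|n IHn].
  by rewrite /wallis /= cos_pihalf subr0 /cbin big_ord0 mulr1 invr1.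
rewrite doubleS wallisSS IHn cbinS.
have := cbin_gt0 n; move: (cbin n) => c c0.
have n0 k : k.+1%:R != 0 :> R by rewrite pnatr_eq0.
have c1 : c != 0 by rewrite gt_eqF.
have := n0 n.*2.+2; have := n0 n.*2.+1; have := n0 n.*2.
move: (n.*2.+3%:R) (n.*2.+2%:R) (n.*2.+1%:R) => a b d d0 b0 a0.
by field; rewrite d0 b0 a0 c1.
Qed.

(** This is [wallis_anti] from index 2n to 2n + 1; the upper bound below comes from the next pair of
    indices. *)
Lemma cbin_lower n : 2 / pi <= n.*2.+1%:R * cbin n ^+ 2.
Proof.
have := wallis_anti n.*2; rewrite wallis_odd wallis_even.
have c0 := cbin_gt0 n; have n0 : 0 < n.*2.+1%:R :> R by rewrite ltr0n.
have p0 := pi_gt0 R.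
rewrite invf_ple ?posrE ?mulr_gt0 ?divr_gt0 ?invr_gt0 //.
rewrite invfM invf_div => h.
have -> : 2 / pi = 2 / pi / cbin n * cbin n by rewrite divfK // gt_eqF.
by rewrite expr2 mulrA ler_pM2r.
Qed.

Lemma cbin_upper n : n%:R * cbin n ^+ 2 <= pi^-1.
Proof.
case: n => [|n]; first by rewrite mul0r invr_ge0 pi_ge0.
have := wallis_anti n.*2.+1; rewrite wallis_odd -doubleS wallis_even.
have -> : n.*2.+1%:R * cbin n = n.*2.+2%:R * cbin n.+1.
  by rewrite cbinS mulrA mulrCA divff ?mulr1 // pnatr_eq0.
have c0 := cbin_gt0 n.+1; have p0 := pi_gt0 R.
have n0 : 0 < n.*2.+2%:R :> R by rewrite ltr0n.
rewrite -ler_pdivlMl ?divr_gt0 // => h.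
have {h} h : cbin n.+1 * (n.*2.+2%:R * cbin n.+1) <= (pi / 2)^-1.
  by rewrite -ler_pdivlMr ?mulr_gt0.
have -> : n.+1%:R * cbin n.+1 ^+ 2 = 2^-1 * (cbin n.+1 * (n.*2.+2%:R * cbin n.+1)).
  by rewrite -doubleS -mul2n natrM; field.
by rewrite ler_pdivrMl //; move: h; rewrite invf_div.
Qed.

(** The two bounds enclose the sequence between (1 - 1 / (n + 1)) / pi and 1 / pi. *)
Lemma cvg_cbin : (fun n : nat => n%:R * cbin n ^+ 2) @ \oo --> (pi^-1 : R).
Proof.
have p0 := pi_gt0 R.
apply: (@squeeze_cvgr _ _ _ _ (fun n => pi^-1 * (1 - harmonic n)) (fun=> pi^-1)).
- near=> n; rewrite cbin_upper andbT.
  have := cbin_lower n; rewrite -mul2n -[(2 * n).+1%:R]natr1 natrM.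
  have n0 : 0 < n%:R + 1 :> R by rewrite natr1 ltr0n.
  have nn0 : 0 <= n%:R :> R by rewrite ler0n.
  rewrite /harmonic /= -[n.+1%:R]natr1.
  have -> : 1 - (n%:R + 1)^-1 = n%:R / (n%:R + 1) :> R.
    by apply: (mulIf (lt0r_neq0 n0)); rewrite mulrBl !mulVf ?divfK ?lt0r_neq0 // mul1r addrK.
  move: (cbin n ^+ 2) (sqr_ge0 (cbin n)) => c c0 h.
  rewrite mulrA ler_pdivrMr //.
  have h2 : pi^-1 <= (n%:R + 1) * c.
    have : 2 * pi^-1 <= 2 * ((n%:R + 1) * c).
      by apply: le_trans h _; nra.
    by rewrite ler_pM2l.
  by rewrite mulrC -mulrA ler_wpM2l // mulrC.
- rewrite -[X in _ --> X]mulr1; apply: cvgM; first exact: cvg_cst.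
  rewrite -[X in _ --> X](subr0 1); apply: cvgB; first exact: cvg_cst.
  exact: cvg_harmonic.
- exact: cvg_cst.
Unshelve. all: by end_near.
Qed.

End Wallis.

(** * Values at t = 1/4 *)


Section Evaluation.
Variable R : realType.
Implicit Types a b : nat -> R.

(** * Absolutely convergent series and their Cauchy products *)

Definition psum a (n : nat) : R := \sum_(i < n) a i.

Definition abs_summable a := exists M, forall n, psum (fun i => `|a i|) n <= M.

Definition cauchy_prod a b (n : nat) : R := \sum_(i < n.+1) a i * b (n - i)%N.

Lemma psum0 a : psum a 0 = 0.
Proof. exact: big_ord0. Qed.

Lemma psumS a n : psum a n.+1 = psum a n + a n.
Proof. by rewrite /psum big_ord_recr. Qed.

Lemma psum_split a m n : psum a (m + n) = psum a m + psum (fun i => a (m + i)%N) n.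
Proof. by rewrite /psum big_split_ord. Qed.

Lemma psum_ge0 a n : (forall i, 0 <= a i) -> 0 <= psum a n.
Proof. by move=> a0; apply: sumr_ge0. Qed.

Lemma psum_homo a m n : (forall i, 0 <= a i) -> (m <= n)%N -> psum a m <= psum a n.
Proof.
move=> a0 /subnKC <-; rewrite psum_split lerDl; exact: psum_ge0.
Qed.

Lemma ler_norm_psumB a m n : (m <= n)%N ->
  `|psum a n - psum a m| <=
  psum (fun i => `|a i|) n - psum (fun i => `|a i|) m.
Proof.
move=> /subnKC <-; rewrite !psum_split addrC addKr addrAC subrr add0r.
exact: ler_norm_sum.
Qed.

Lemma psum_cauchy_prod a b n :
  psum (cauchy_prod a b) n = \sum_(i < n) a i * psum b (n - i).
Proof.
elim: n => [|n IHn]; first by rewrite /psum !big_ord0.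
rewrite psumS IHn /cauchy_prod [in LHS]big_ord_recr [in RHS]big_ord_recr /=.
rewrite subnn subSnn psumS psum0 add0r.
rewrite addrA -big_split /=; congr (_ + _); apply: eq_bigr => i _.
by rewrite subSn ?(ltnW (ltn_ord i)) // psumS mulrDr.
Qed.

Lemma cvg_half : (fun n : nat => n./2) @ \oo --> \oo.
Proof.
apply/cvgnyPge => M; exists M.*2 => // n /= Mn.
by rewrite -(doubleK M) half_leq.
Qed.

Lemma cvg_uphalf : (fun n : nat => uphalf n) @ \oo --> \oo.
Proof.
apply/cvgnyPge => M; exists M.*2 => // n /= Mn.
by rewrite -(uphalf_double M) uphalf_leq.
Qed.

(** For the absolute values, let P_n be the product of the partial sums and G_n the partial sum of
    the Cauchy product; then G_n <= P_n <= G_(2n). For a and b themselves, these two quantities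
    differ by at most P_n - G_n <= P_n - P_(n/2), which tends to 0 because P is bounded and
    monotone. *)
Lemma cvg_cauchy_prod a b (A B : R) :
  abs_summable a -> abs_summable b ->
  psum a @ \oo --> A -> psum b @ \oo --> B ->
  abs_summable (cauchy_prod a b) /\ psum (cauchy_prod a b) @ \oo --> A * B.
Proof.
move=> [M aM] [N bN] aA bB.
pose al i := `|a i|; pose be i := `|b i|.
have al0 i : 0 <= al i by apply: normr_ge0.
have be0 i : 0 <= be i by apply: normr_ge0.
pose P n := psum al n * psum be n; pose Ga := psum (cauchy_prod al be).
have GaP n : Ga n <= P n.
  rewrite /Ga psum_cauchy_prod /P mulr_suml; apply: ler_sum => i _.
  by apply: ler_wpM2l => //; apply: psum_homo; rewrite ?leq_subr.
have PM n : P n <= M * N by apply: ler_pM; rewrite ?psum_ge0.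
have PGa n : P n <= Ga (n + n)%N.
  rewrite /Ga psum_cauchy_prod big_split_ord /= /P mulr_suml.
  apply: ler_wpDr.
    by apply: sumr_ge0 => i _; rewrite mulr_ge0 ?psum_ge0.
  apply: ler_sum => i _; apply: ler_wpM2l => //; apply: psum_homo => //.
  by rewrite -addnBA ?leq_addr // ltnW.
have Ga0 i : 0 <= cauchy_prod al be i.
  by apply: sumr_ge0 => j _; rewrite mulr_ge0.
have leGa i : `|cauchy_prod a b i| <= cauchy_prod al be i.
  apply: le_trans (ler_norm_sum _ _ _) _; apply: ler_sum => j _.
  by rewrite normrM.
split.
  exists (M * N) => n; apply: le_trans (PM n); apply: le_trans (GaP n).
  by apply: ler_sum => i _.
have Phomo m n : (m <= n)%N -> P m <= P n.
  by move=> mn; apply: ler_pM; rewrite ?psum_ge0 ?psum_homo.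
have cP : cvgn P.
  apply: nondecreasing_is_cvgn; first by move=> m n; apply: Phomo.
  by exists (M * N) => _ [n _ <-].
have cP2 : (fun n => P n./2) @ \oo --> limn P.
  exact: (cvg_comp _ _ cvg_half cP).
have diff0 : (fun n => psum a n * psum b n - psum (cauchy_prod a b) n) @ \oo --> (0 : R).
  apply: (@squeeze_cvgr _ _ _ _ (fun n => - (P n - P n./2)) (fun n => P n - P n./2)).
  - near=> n; rewrite -ler_norml psum_cauchy_prod mulr_suml -sumrB.
    apply: (@le_trans _ _ (P n - Ga n)); last first.
      rewrite lerB // (le_trans (PGa _)) //; apply: psum_homo => //; lia.
    rewrite /Ga psum_cauchy_prod /P mulr_suml -sumrB.
    apply: le_trans (ler_norm_sum _ _ _) _; apply: ler_sum => i _.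
    rewrite -!mulrBr normrM; apply: ler_wpM2l => //.
    by apply: ler_norm_psumB; rewrite leq_subr.
  - rewrite -[X in _ --> X]oppr0; apply: cvgN.
    by rewrite -(subrr (limn P)); apply: cvgB.
  - by rewrite -(subrr (limn P)); apply: cvgB.
have -> : psum (cauchy_prod a b) = (fun n => psum a n * psum b n -
    (psum a n * psum b n - psum (cauchy_prod a b) n)).
  by apply/funext => n; rewrite opprB addrC subrK.
rewrite -[X in _ --> X]subr0; apply: cvgB => //; exact: cvgM.
Unshelve. all: by end_near.
Qed.

Definition term4 (f : fps) (n : nat) : R := ratr (f n) * 4^-1 ^+ n.

(** Absolute summability is kept along with the limit so that products can be evaluated. *)
Definition value4 (f : fps) (l : R) :=
  abs_summable (term4 f) /\ psum (term4 f) @ \oo --> l.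

Lemma value4_add f g k l : value4 f k -> value4 g l -> value4 (f + g) (k + l).
Proof.
move=> [[M fM] fk] [[N gN] gl].
have fgE n : term4 (f + g) n = term4 f n + term4 g n.
  by rewrite /term4 fps_coefD rmorphD mulrDl.
split.
  exists (M + N) => n; apply: le_trans (lerD (fM n) (gN n)).
  by rewrite /psum -big_split; apply: ler_sum => i _; rewrite fgE ler_normD.
have -> : psum (term4 (f + g)) = psum (term4 f) \+ psum (term4 g).
  by apply/funext => n; rewrite /psum /= -big_split; apply: eq_bigr => i _; rewrite fgE.
exact: cvgD.
Qed.

Lemma value4_mul f g k l : value4 f k -> value4 g l -> value4 (f * g) (k * l).
Proof.
move=> [fs fk] [gs gl]; rewrite /value4.
have -> : term4 (f * g) = cauchy_prod (term4 f) (term4 g).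
  apply/funext => n; rewrite /term4 fps_coefM rmorph_sum mulr_suml.
  apply: eq_bigr => i _; rewrite rmorphM [RHS]mulrACA -exprD subnKC //.
  by rewrite -ltnS.
exact: cvg_cauchy_prod.
Qed.

Lemma value4_poly p : value4 (fps_of_poly p) (ratr p.[4^-1]).
Proof.
have t0 i : (size p <= i)%N -> term4 (fps_of_poly p) i = 0.
  by move=> pi; rewrite /term4 fps_polyE nth_default // rmorph0 mul0r.
split.
  exists (psum (fun i => `|term4 (fps_of_poly p) i|) (size p)) => n.
  apply: (@le_trans _ _ (psum (fun i => `|term4 (fps_of_poly p) i|) (size p + n)%N)).
    by apply: psum_homo; rewrite ?leq_addl.
  rewrite psum_split /psum [X in _ + X]big1 ?addr0 // => i _.
  by rewrite t0 ?leq_addr // normr0.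
apply: cvg_near_cst; exists (size p) => // n /= /subnKC <-.
apply/eqP; rewrite eq_sym psum_split /psum [X in _ + X]big1 ?addr0 => [|i _].
  rewrite horner_coef rmorph_sum; apply/eqP/eq_bigr => i _.
  by rewrite /term4 rmorphM rmorphXn /= fmorphV rmorph_nat.
by rewrite t0 ?leq_addr.
Qed.

(** The rational number C(2n, n) / 4^n, the counterpart of [cbin]. *)
Definition cbinq n : rat := rising 2^-1 n / n`!%:R.

Lemma cbinq0 : cbinq 0 = 1.
Proof. by rewrite /cbinq /rising big_ord0 fact0 divr1. Qed.

Lemma cbinqS n : cbinq n.+1 = n.*2.+1%:R / n.*2.+2%:R * cbinq n.
Proof.
rewrite /cbinq /rising big_ord_recr /= factS natrM.
have f0 : n`!%:R != 0 :> rat by rewrite pnatr_eq0 -lt0n fact_gt0.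
have n0 : n.+1%:R != 0 :> rat by rewrite pnatr_eq0.
rewrite -[n.*2.+2]doubleS -!mul2n -[(2 * n).+1%:R]natr1 !natrM.
rewrite -[n.+1%:R]natr1 in n0 *.
by move: (\prod_(i < n) _) (n`!%:R) (n%:R) f0 n0 => x y z y0 z0; field; rewrite y0 z0.
Qed.

Lemma ratr_cbinq n : ratr (cbinq n) = cbin R n.
Proof.
elim: n => [|n IHn].
  by rewrite /cbinq /cbin /rising !big_ord0 fact0 divr1 rmorph1.
by rewrite cbinqS cbinS rmorphM /= IHn fmorph_div !rmorph_nat.
Qed.

(** The two rising factorials share all but their extreme factors: (2n - 1) (-1/2)_n = - (1/2)_n. *)
Lemma rising_half n :
  rising (- 2^-1) n / n`!%:R = - cbinq n / (2 * n%:R - 1).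
Proof.
have odd_neq0 : 2 * n%:R - 1 != 0 :> rat.
  rewrite subr_eq0 -natrM -[1]/(1%:R) eqr_nat; apply/eqP; lia.
apply: (mulIf odd_neq0); rewrite divfK // /cbinq mulrAC -mulNr; congr (_ / _).
elim: n {odd_neq0} => [|n IHn]; first by rewrite /rising !big_ord0; ring.
move: IHn; rewrite /rising !big_ord_recr /=.
move: (\prod_(i < n) _) (\prod_(i < n) _) => x y IHn.
rewrite -[n.+1%:R]natr1.
have -> : y * (- 2^-1 + n%:R) = 2^-1 * (y * (2 * n%:R - 1)) by field.
by rewrite IHn; field.
Qed.

(** * Closed forms of the partial sums at t = 1/4 *)

Definition hyp1 := hyp2F1_coef (- 2^-1) (- 2^-1) 1.
Definition hyp2 := hyp2F1_coef (- 2^-1) 2^-1 2.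

Lemma odd_neq0 n : 2 * n%:R + 1 != 0 :> rat.
Proof. by rewrite -natrM natr1 pnatr_eq0. Qed.

Lemma cbinq_pred n : cbinq n = (2 * n%:R + 2) / (2 * n%:R + 1) * cbinq n.+1.
Proof.
rewrite cbinqS -[n.*2.+2]doubleS -!mul2n -[(2 * n).+1%:R]natr1 !natrM -[n.+1%:R]natr1.
have n0 : n%:R + 1 != 0 :> rat by rewrite natr1 pnatr_eq0.
by have := odd_neq0 n; move: (n%:R) n0 => x x0 x1; field; rewrite x1 x0.
Qed.

Lemma hyp1E n : hyp1 n = (cbinq n / (2 * n%:R - 1)) ^+ 2.
Proof.
have -> : hyp1 n = (rising (- 2^-1) n / n`!%:R) ^+ 2.
  rewrite /hyp1 /hyp2F1_coef; have -> : rising 1 n = n`!%:R.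
    elim: n => [|n IHn]; first by rewrite /rising big_ord0.
    by rewrite /rising big_ord_recr /= [X in X * _]IHn factS natrM nat1r mulrC.
  by rewrite expr2 -!mulrA; congr (_ * _); rewrite mulrCA.
by rewrite rising_half mulNr sqrrN.
Qed.

Lemma hyp2E n : hyp2 n = - cbinq n ^+ 2 / ((2 * n%:R - 1) * n.+1%:R).
Proof.
have -> : hyp2 n = (rising (- 2^-1) n / n`!%:R) * cbinq n / n.+1%:R.
  rewrite /hyp2 /hyp2F1_coef; have -> : rising 2 n = n.+1`!%:R.
    elim: n => [|n IHn]; first by rewrite /rising big_ord0.
    rewrite /rising big_ord_recr /= [X in X * _]IHn [in RHS]factS natrM mulrC.
    by rewrite -natrD.
  rewrite /cbinq factS natrM invfM.
  move: (rising (- 2^-1) n) (rising 2^-1 n) (n.+1%:R^-1) (n`!%:R^-1) => x y u v.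
  by ring.
rewrite rising_half invfM; move: (cbinq n) (n.+1%:R^-1) ((2 * n%:R - 1)^-1) => c u v.
by ring.
Qed.

(** A telescoping sum, checked by induction. Its leading part 4 n c_n^2, with c_n = C(2n, n) / 4^n,
    tends to 4 / pi by Wallis's product. *)
Lemma hyp1_sum n : \sum_(k < n.+1) hyp1 k = (4 * n%:R + 1) * cbinq n ^+ 2.
Proof.
elim: n => [|n IHn].
  by rewrite big_ord1 hyp1E cbinq0 !mulr0 sub0r add0r invrN1 mulrN1 sqrrN.
rewrite big_ord_recr /= IHn hyp1E cbinq_pred -[n.+1%:R]natr1.
have := odd_neq0 n; move: (n%:R) (cbinq _) => x c x0.
have -> : 2 * (x + 1) - 1 = 2 * x + 1 by ring.
by field; rewrite ?x0.
Qed.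

(** Telescoping as well; the leading part (8/3) n c_n^2 yields the limit 8 / (3 pi). *)
Lemma hyp2_sum n : \sum_(k < n.+1) hyp2 k =
  3^-1 * ((8 * n%:R + 2) * cbinq n ^+ 2 + cbinq n ^+ 2 / n.+1%:R).
Proof.
elim: n => [|n IHn].
  by rewrite big_ord1 hyp2E /= cbinq0; field.
rewrite big_ord_recr /= IHn hyp2E cbinq_pred -[n.+2%:R]natr1 -[n.+1%:R]natr1.
have n1 : n%:R + 1 != 0 :> rat by rewrite natr1 pnatr_eq0.
have n2 : n%:R + 1 + 1 != 0 :> rat by rewrite !natr1 pnatr_eq0.
have := odd_neq0 n; move: (n%:R) (cbinq _) n1 n2 => x c n1 n2 x0.
have -> : 2 * (x + 1) - 1 = 2 * x + 1 by ring.
by field; rewrite ?x0 ?n1 ?n2.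
Qed.

Lemma sqrt_sum n : \sum_(k < n.+1) rising (- 2^-1) k / k`!%:R = cbinq n.
Proof.
elim: n => [|n IHn].
  by rewrite big_ord1 cbinq0 /rising big_ord0 fact0 divr1.
rewrite big_ord_recr /= IHn rising_half cbinq_pred -[n.+1%:R]natr1.
have := odd_neq0 n; move: (n%:R) (cbinq _) => x c x0.
have -> : 2 * (x + 1) - 1 = 2 * x + 1 by ring.
by field; rewrite ?x0.
Qed.

Lemma cvg_cbin_sqr : (fun n => cbin R n ^+ 2) @ \oo --> (0 : R).
Proof.
rewrite -cvg_shiftS.
apply: (@squeeze_cvgr _ _ _ _ (fun=> 0) (fun n => pi^-1 * harmonic n)).
- near=> n; rewrite sqr_ge0 /=.
  have := cbin_upper R n.+1.
  by rewrite /harmonic /= -ler_pdivlMl ?ltr0n // mulrC.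
- exact: cvg_cst.
- rewrite -(mulr0 (pi^-1 : R)); apply: cvgM; first exact: cvg_cst.
  exact: cvg_harmonic.
Unshelve. all: by end_near.
Qed.

Lemma cvg_cbin0 : cbin R @ \oo --> (0 : R).
Proof.
apply/cvgrPdist_lt => e e0.
have e20 : 0 < e ^+ 2 by rewrite exprn_gt0.
have /cvgrPdist_lt /(_ _ e20) := cvg_cbin_sqr.
apply: filterS => n; rewrite !sub0r !normrN.
rewrite ger0_norm ?sqr_ge0 // ger0_norm ?ltW ?cbin_gt0 //.
by rewrite ltr_pXn2r // nnegrE ltW // cbin_gt0.
Qed.

(** At t = 1/4 the factor 16^k is cancelled, and [uphalf n] of the first n indices are even. Taking
    for phi the identity or the absolute value serves both convergence and absolute summability. *)
Lemma psum_hyp (a b c : rat) (phi : R -> R) n : phi 0 = 0 ->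
  psum (fun i => phi (term4 (hyp2F1_16t2 a b c) i)) n =
  psum (fun k => phi (ratr (hyp2F1_coef a b c k))) (uphalf n).
Proof.
move=> phi0; elim: n => [|n IHn]; first by rewrite /psum !big_ord0.
rewrite psumS IHn /term4 /= uphalf_half; case: ifP => on /=.
  by rewrite rmorph0 mul0r phi0 addr0 add1n.
rewrite add0n psumS; congr (_ + phi _).
rewrite rmorphM rmorphXn rmorph_nat -[in 4^-1 ^+ n](odd_double_half n) on add0n.
rewrite -mul2n exprM -mulrA -exprMn (_ : 16 * _ = 1) ?expr1n ?mulr1 //.
by rewrite exprVn -natrX mulfV // pnatr_eq0.
Qed.

Lemma abs_psum_neg a n : 0 <= a 0%N -> (forall k, a k.+1 <= 0) ->
  psum (fun k => `|a k|) n.+1 = a 0%N *+ 2 - psum a n.+1.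
Proof.
move=> a0 aS; elim: n => [|n IHn].
  by rewrite /psum !big_ord1 ger0_norm // mulr2n addrK.
by rewrite psumS IHn [psum a n.+2]psumS ler0_norm // opprD addrA.
Qed.

Lemma cbinq_ge0 n : 0 <= cbinq n.
Proof.
rewrite /cbinq divr_ge0 // /rising; apply: prodr_ge0 => i _.
by rewrite addr_ge0.
Qed.

Lemma value4_H1 : value4 (hyp2F1_16t2 (- 2^-1) (- 2^-1) 1) (4 * pi^-1).
Proof.
have cvgT : psum (fun k => ratr (hyp1 k)) @ \oo --> (4 * pi^-1 : R).
  have lim4 : (fun n => 4 * (n%:R * cbin R n ^+ 2) + cbin R n ^+ 2) @ \oo -->
      (4 * pi^-1 + 0 : R).
    by apply: cvgD cvg_cbin_sqr; apply: cvgM; [apply: cvg_cst|apply: cvg_cbin].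
  rewrite addr0 in lim4; rewrite -cvg_shiftS.
  have -> : [sequence psum (fun k => ratr (hyp1 k)) n.+1]_n =
      (fun n => 4 * (n%:R * cbin R n ^+ 2) + cbin R n ^+ 2) => //.
  apply/funext => n; rewrite /= /psum -rmorph_sum hyp1_sum.
  rewrite rmorphM rmorphD rmorphM !rmorph_nat rmorph1 rmorphXn /= ratr_cbinq.
  by rewrite mulrDl mul1r mulrA.
have cvgS : psum (term4 (hyp2F1_16t2 (- 2^-1) (- 2^-1) 1)) @ \oo --> (4 * pi^-1 : R).
  have -> : psum (term4 (hyp2F1_16t2 (- 2^-1) (- 2^-1) 1)) =
     psum (fun k => ratr (hyp1 k)) \o uphalf.
    by apply/funext => n; apply: (@psum_hyp _ _ _ id).
  exact: (cvg_comp _ _ cvg_uphalf cvgT).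
split => //; exists (4 * pi^-1) => n.
rewrite psum_hyp ?normr0 // -(cvg_lim _ cvgT) //.
have h0 k : 0 <= ratr (hyp1 k) :> R by rewrite ler0q hyp1E sqr_ge0.
have -> : psum (fun k => `|ratr (hyp1 k) : R|) (uphalf n) =
    psum (fun k => ratr (hyp1 k)) (uphalf n).
  by apply: eq_bigr => k _; rewrite ger0_norm.
apply: nondecreasing_cvgn_le; last by apply/cvg_ex; exists (4 * pi^-1).
by move=> i j; apply: psum_homo.
Qed.

(** The partial sums of absolute values equal 2 a_0 minus the plain ones, hence are at most 2
    a_0. *)
Lemma abs_summable_neg a : 0 <= a 0%N -> (forall k, a k.+1 <= 0) ->
  (forall n, 0 <= psum a n.+1) -> abs_summable a.
Proof.
move=> a0 aS psum0; exists (a 0%N *+ 2) => -[|n].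
  by rewrite /psum big_ord0 mulrn_wge0.
by rewrite abs_psum_neg // gerBl.
Qed.

Lemma value4_H2 : value4 (hyp2F1_16t2 (- 2^-1) 2^-1 2) (8 / 3 * pi^-1).
Proof.
have TE n : psum (fun k => ratr (hyp2 k)) n.+1 = 8 / 3 * (n%:R * cbin R n ^+ 2) +
    (2 / 3 * cbin R n ^+ 2 + 3^-1 * (cbin R n ^+ 2 * harmonic n)).
  rewrite /psum -rmorph_sum hyp2_sum.
  have c2E : ratr (cbinq n ^+ 2) = cbin R n ^+ 2 :> R by rewrite rmorphXn /= ratr_cbinq.
  rewrite -c2E /harmonic /=; move: (cbinq n ^+ 2) => c.
  by rewrite !(rmorph_nat, fmorphV, rmorphM, rmorphD) /=; ring.
have cvgT : psum (fun k => ratr (hyp2 k)) @ \oo --> (8 / 3 * pi^-1 : R).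
  have lim2 : (fun n => 8 / 3 * (n%:R * cbin R n ^+ 2) +
      (2 / 3 * cbin R n ^+ 2 + 3^-1 * (cbin R n ^+ 2 * harmonic n))) @ \oo -->
      (8 / 3 * pi^-1 + (2 / 3 * 0 + 3^-1 * (0 * 0)) : R).
    apply: cvgD; first by apply: cvgM; [apply: cvg_cst|apply: cvg_cbin].
    apply: cvgD; first by apply: cvgM; [apply: cvg_cst|apply: cvg_cbin_sqr].
    apply: cvgM; first exact: cvg_cst.
    by apply: cvgM; [apply: cvg_cbin_sqr|apply: cvg_harmonic].
  rewrite !mulr0 !addr0 in lim2; rewrite -cvg_shiftS.
  have -> : [sequence psum (fun k => ratr (hyp2 k)) n.+1]_n =
      (fun n => 8 / 3 * (n%:R * cbin R n ^+ 2) +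
      (2 / 3 * cbin R n ^+ 2 + 3^-1 * (cbin R n ^+ 2 * harmonic n))) => //.
  by apply/funext => n; rewrite -TE.
split; last first.
  have -> : psum (term4 (hyp2F1_16t2 (- 2^-1) 2^-1 2)) =
     psum (fun k => ratr (hyp2 k)) \o uphalf.
    by apply/funext => n; apply: (@psum_hyp _ _ _ id).
  exact: (cvg_comp _ _ cvg_uphalf cvgT).
have [M hM] : abs_summable (fun k => ratr (hyp2 k)).
  apply: abs_summable_neg => [|k|n].
  - rewrite ler0q hyp2E mulr0 sub0r mulr1 invrN1 mulrN1 opprK sqr_ge0 //.
  - rewrite lerq0 hyp2E mulNr oppr_le0 divr_ge0 ?sqr_ge0 // mulr_ge0 //.
    by rewrite subr_ge0 -natrM (ler_nat _ 1).
  - by rewrite TE !addr_ge0 // !mulr_ge0 ?sqr_ge0 ?invr_ge0 ?ler0n // ltW ?cbin_gt0.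
by exists M => n; rewrite psum_hyp ?normr0.
Qed.

(** The partial sums are C(2n, n) / 4^n, which tends to 0. *)
Lemma value4_sqrt : value4 fps_sqrt14t 0.
Proof.
pose r k : R := ratr (rising (- 2^-1) k / k`!%:R).
have tE : term4 fps_sqrt14t = r.
  apply/funext => n; rewrite /term4 /r /= rmorphM rmorphXn rmorph_nat -mulrA.
  by rewrite exprVn mulfV ?mulr1 // expf_neq0 // pnatr_eq0.
have rE n : psum r n.+1 = cbin R n.
  by rewrite -ratr_cbinq -sqrt_sum rmorph_sum.
rewrite /value4 tE; split.
  apply: abs_summable_neg => [|k|n]; last by rewrite rE ltW // cbin_gt0.
    by rewrite /r /rising big_ord0 fact0 divr1 rmorph1.
  rewrite /r lerq0 rising_half mulNr oppr_le0 divr_ge0 ?cbinq_ge0 //.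
  by rewrite subr_ge0 -natrM (ler_nat _ 1).
rewrite -cvg_shiftS; have -> : [sequence psum r n.+1]_n = cbin R by apply/funext.
exact: cvg_cbin0.
Qed.

(** A Laurent series is evaluated after multiplication by some t^N. The size bound means degree at
    most floor (d / 2) in 1 / pi. *)
Definition pi_value (d : nat) (b : laurent) := exists N f (p : {poly rat}),
  [/\ b * laurent_t ^+ N = laurent_of f,
      value4 f (map_poly ratr p).[pi^-1] & (size p <= d./2.+1)%N].

Lemma value4_Xn f (p : {poly rat}) (x : R) M : value4 f (map_poly ratr p).[x] ->
  value4 (f * fps_of_poly 'X^M) (map_poly ratr (4^-1 ^+ M *: p)).[x].
Proof.
move=> fp; rewrite map_polyZ hornerZ mulrC; apply: value4_mul => //.
by have := value4_poly 'X^M; rewrite hornerXn.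
Qed.

(** H1 and H2, of degree 2, bring one factor 1 / pi each, and sqrt (1 - 4 t) has value 0. For
    products, floor (d / 2) + floor (e / 2) <= floor ((d + e) / 2). *)
Lemma pi_value_expressible r d (b : laurent) : expressible r d b -> pi_value d b.
Proof.
elim=> {d b} [d b|||_|d b c _ IHb _ IHc|d e b c _ IHb _ IHc|d e b de _].
- move=> [q [n ->]]; exists n, (fps_of_poly q), (q.[4^-1])%:P; split.
  + by rewrite divfK // expf_neq0 // laurent_t_neq0.
  + by rewrite map_polyC hornerC; apply: value4_poly.
  + by rewrite (leq_trans (size_polyC_leq1 _)).
- exists 0%N, (hyp2F1_16t2 (- 2^-1) (- 2^-1) 1), (4 *: 'X); split.
  + by rewrite mulr1.
  + rewrite map_polyZ map_polyX hornerZ hornerX /= rmorph_nat; exact: value4_H1.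
  + by rewrite (leq_trans (size_scale_leq _ _)) // size_polyX.
- exists 0%N, (hyp2F1_16t2 (- 2^-1) 2^-1 2), ((8 / 3) *: 'X); split.
  + by rewrite mulr1.
  + rewrite map_polyZ map_polyX hornerZ hornerX fmorph_div !rmorph_nat.
    exact: value4_H2.
  + by rewrite (leq_trans (size_scale_leq _ _)) // size_polyX.
- exists 0%N, fps_sqrt14t, 0; split; rewrite ?mulr1 ?size_poly0 //.
  by rewrite rmorph0 horner0; apply: value4_sqrt.
- case: IHb => N [f [p [bN fp sp]]]; case: IHc => M [g [q [cM gq sq]]].
  (* Both summands are brought to the common factor t^(N + M); the extra powers of t contribute
     4^(-M) and 4^(-N). *)
  exists (N + M)%N, (f * fps_of_poly 'X^M + g * fps_of_poly 'X^N).
  exists (4^-1 ^+ M *: p + 4^-1 ^+ N *: q); split.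
  + rewrite tofracD !tofracM !fps_of_polyXn !tofracXn -bN -cM -/laurent_t exprD.
    by rewrite mulrDl !mulrA; congr (_ + _); rewrite mulrAC.
  + by rewrite rmorphD hornerD; apply: value4_add; apply: value4_Xn.
  + apply: leq_trans (size_polyD _ _) _; rewrite geq_max.
    by rewrite !(leq_trans (size_scale_leq _ _)).
- case: IHb => N [f [p [bN fp sp]]]; case: IHc => M [g [q [cM gq sq]]].
  exists (N + M)%N, (f * g), (p * q); split.
  + by rewrite tofracM -bN -cM exprD mulrACA.
  + by rewrite rmorphM hornerM; apply: value4_mul.
  + apply: leq_trans (size_polyMleq _ _) _; lia.
- move=> [N [f [p [bN fp sp]]]]; exists N, f, p; split=> //.
  by apply: leq_trans sp _; rewrite ltnS half_leq.
Qed.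

(** Dividing t^N S by t^N shifts the partial sums by N and multiplies the value by 4^N. *)
Lemma pi_value_cvg d (S : fps) : pi_value d (laurent_of S) ->
  exists2 p : {poly rat}, (size p <= d./2.+1)%N &
    pseries (fun n => ratr (S n) : R) (4^-1) @ \oo --> (map_poly ratr p).[pi^-1].
Proof.
move=> [N [f [p [SN [_ fp] sp]]]]; exists (4 ^+ N *: p).
  by rewrite (leq_trans (size_scale_leq _ _)).
have {SN} fE : f = fps_t ^+ N * S.
  by apply/eqP; rewrite -tofrac_eq -SN tofracM tofracXn mulrC.
have tN i : term4 f (N + i) = 4^-1 ^+ N * term4 S i.
  rewrite fE /term4; elim: (N) => [|M IHM]; first by rewrite !expr0 !mul1r.
  by rewrite addSn !exprS -[_ * _ * S]mulrA fps_coef_tM mulrCA IHM !mulrA.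
have t0 i : (i < N)%N -> term4 f i = 0.
  move=> iN; rewrite fE /term4 -fps_of_polyXn fps_coefM.
  rewrite big1 ?rmorph0 ?mul0r // => j _.
  by rewrite fps_polyE coefXn (_ : (_ == _) = false) ?mul0r //; have := ltn_ord j; lia.
have -> : pseries (fun n => ratr (S n) : R) 4^-1 =
    (fun n => 4 ^+ N * psum (term4 f) (n + N)).
  apply/funext => n; rewrite /pseries /series /= big_mkord addnC psum_split.
  have -> : psum (term4 f) N = 0 by apply: big1 => i _; rewrite t0.
  rewrite add0r.
  rewrite /psum mulr_sumr; apply: eq_bigr => i _.
  by rewrite tN mulrA exprVn mulfV ?mul1r // expf_neq0 // pnatr_eq0.
rewrite map_polyZ hornerZ rmorphXn rmorph_nat; apply: cvgM; first exact: cvg_cst.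
by rewrite (cvg_shiftn N (psum (term4 f))).
Qed.

End Evaluation.

Theorem theorem1 (V : finType) (E : {set {set V}}) (hT : is_tree E)
    (R : realType) :
  [/\ #|half_edges E| = 0%N -> laurent_of (treeS E) \in algA,
      #|half_edges E| = 1%N -> laurent_of (treeS E) \in algB,
      (degB (laurent_of (treeS E)) <= #|V|)%N
    & exists2 p : {poly rat},
        (size p <= (#|V|./2).+1)%N
      & pseries (fun n => ratr (treeS E n) : R) (4^-1) @ \oo -->
          (map_poly ratr p).[pi^-1]].
Proof.
(* Degree and value are derived with the square root allowed, which covers both cases; membership in
   [algA] uses the sharper form without it. *)
have half1 : (#|half_edges E| <= true)%N by case: hT.
have exprB := expressible_treeS hT half1.
split.
- move=> half0; apply: (@expressible_algA #|V|).
  by apply: expressible_treeS => //; rewrite half0.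
- by move=> _; apply: expressible_algB exprB.
- exact: expressible_degB exprB.
- exact: pi_value_cvg (pi_value_expressible R exprB).
Qed.
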